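(* For every integer $n\ge1$ there is a constant $C_n>0$ depending only on $n$ such that the following holds. Let $\lambda\in(0,1)$, $\tau=\min(\lambda,1-\lambda)$, $\varepsilon>0$, and let $h,f,g:\mathbb{R}^n\to[0,\infty)$ be measurable radial functions with $0<\int_{\mathbb{R}^n} f<\infty$ and $0<\int_{\mathbb{R}^n} g<\infty$, such that $$h(\lambda x+(1-\lambda)y)\ge f(x)^{\lambda}g(y)^{1-\lambda}\qquad\text{for all }x,y\in\mathbb{R}^n.$$ Suppose moreover that either $h$ is log-concave or that $f$ and $g$ are log-concave, and that $$\int_{\mathbb{R}^n}h(x)\,dx\le(1+\varepsilon)\left(\int_{\mathbb{R}^n}f(x)\,dx\right)^{\lambda}\left(\int_{\mathbb{R}^n}g(x)\,dx\right)^{1-\lambda}.$$ Then there are a scalar $a>0$ and a radial log-concave function $\tilde h:\mathbb{R}^n\to[0,\infty)$ such that $$\int_{\mathbb{R}^n}\left|f(x)-a^{1-\lambda}\tilde h(x)\right|dx\le C_n\left(\frac{\varepsilon}{\tau}\right)^{1/2}\int_{\mathbb{R}^n}f(x)\,dx,$$ $$\int_{\mathbb{R}^n}\left|g(x)-a^{-\lambda}\tilde h(x)\right|dx\le C_n\left(\frac{\varepsilon}{\tau}\right)^{1/2}\int_{\mathbb{R}^n}g(x)\,dx,$$ $$\int_{\mathbb{R}^n}|h(x)-\tilde h(x)|\,dx\le C_n\left(\frac{\varepsilon}{\tau}\right)^{1/2}\int_{\mathbb{R}^n}h(x)\,dx.$$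
   Context: A function on $\mathbb{R}^n$ is radial if its value at $x$ depends only on $|x|$. A function $\varphi:\mathbb{R}^n\to[0,\infty)$ is log-concave if $\varphi(sx+(1-s)y)\ge\varphi(x)^{s}\varphi(y)^{1-s}$ for all $x,y\in\mathbb{R}^n$ and $s\in(0,1)$. *)

(* Defs.v *)
From HB Require Import structures.
From mathcomp Require Import all_boot all_order all_algebra.
From mathcomp Require Import all_classical all_reals all_analysis.

Set Implicit Arguments.
Unset Strict Implicit.
Unset Printing Implicit Defensive.
Import Order.TTheory GRing.Theory Num.Theory.
Import numFieldNormedType.Exports.
Local Open Scope classical_set_scope.
Local Open Scope ring_scope.

Section lebesgue_tuple.
Context (R : realType).
Local Open Scope ereal_scope.
Local Notation T n := (n.-tuple (measurableTypeR R)).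

Section step.
Context (n : nat) (mu : {sigma_finite_measure set (T n) -> \bar R}).

Definition tcons (p : measurableTypeR R * T n) : T n.+1 :=
  [tuple of p.1 :: p.2].

Lemma measurable_tcons : measurable_fun [set: measurableTypeR R * T n] tcons.
Proof. exact: measurable_cons. Qed.

Definition lebesgue_step : set (T n.+1) -> \bar R :=
  pushforward (@lebesgue_measure R \x mu) tcons.

Let step0 : lebesgue_step set0 = 0.
Proof. by rewrite /lebesgue_step /pushforward preimage_set0 measure0. Qed.

Let step_ge0 A : 0 <= lebesgue_step A.
Proof. by rewrite /lebesgue_step /pushforward; exact: (measure_ge0 (lebesgue_measure \x mu)). Qed.

Let step_sigma_additive : semi_sigma_additive lebesgue_step.
Proof.
have mp B : measurable B -> measurable (tcons @^-1` B).
  by move=> mB; rewrite -[X in measurable X]setTI; exact: measurable_tcons.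
move=> F mF tF mUF; rewrite /lebesgue_step /pushforward preimage_bigcup.
apply: measure_semi_sigma_additive.
- by move=> k; exact: mp.
- apply/trivIsetP => /= i j _ _ ij; rewrite -preimage_setI.
  by move/trivIsetP : tF => /(_ _ _ _ _ ij) ->//; rewrite preimage_set0.
- by rewrite -preimage_bigcup; exact: mp.
Qed.

HB.instance Definition _ := isMeasure.Build _ _ _ lebesgue_step
  step0 step_ge0 step_sigma_additive.

Let step_sigma_finite : sigma_finite setT lebesgue_step.
Proof.
have /sigma_finiteP[F [FT ndF Foo]] := sigma_finiteT (@lebesgue_measure R).
have /sigma_finiteP[G [GT ndG Goo]] := sigma_finiteT mu.
pose u (x : T n.+1) : measurableTypeR R * T n := (thead x, [tuple of behead x]).
have mu_ : measurable_fun setT u.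
  apply/measurable_fun_pairP; split => /=.
    exact: measurable_tnth.
  exact: measurable_behead.
have FGT : \bigcup_k (F k `*` G k) = setT.
  rewrite -setXTT FT GT predeqE => -[x y]; split.
    by move=> [k _ []/= ? ?]; split; exists k.
  move=> [/= [k _ Fkx] [l _ Gly]]; exists (maxn k l) => //; split.
  - by move: x Fkx; exact/subsetPset/ndF/leq_maxl.
  - by move: y Gly; exact/subsetPset/ndG/leq_maxr.
exists (fun k => u @^-1` (F k `*` G k)).
  by rewrite -preimage_bigcup FGT preimage_setT.
move=> k; have [mF Fk] := Foo k; have [mG Gk] := Goo k; split.
  by rewrite -[X in measurable X]setTI; apply: mu_ => //; exact: measurableX.
rewrite /lebesgue_step /pushforward -comp_preimage.
have -> : u \o tcons = id.
  by apply/funext => -[x y] /=; rewrite /u /tcons /=; congr pair; apply/val_inj.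
by rewrite preimage_id product_measure1E// lte_mul_pinfty// ge0_fin_numE.
Qed.

HB.instance Definition _ := Measure_isSigmaFinite.Build _ _ _ lebesgue_step
  step_sigma_finite.

End step.

(* The product of n copies of the one-dimensional Lebesgue measure, on the
   product (i.e. Borel) sigma-algebra. *)
Fixpoint lebesgue_tuple (n : nat) : {sigma_finite_measure set (T n) -> \bar R} :=
  match n with
  | 0 => \d_([tuple] : T 0)
  | m.+1 => lebesgue_step (lebesgue_tuple m)
  end.

End lebesgue_tuple.

Section lebesgue_Rn.
Context (R : realType) (n : nat).
Local Open Scope ereal_scope.

Definition row_of_tuple (t : n.-tuple R) : 'rV[R]_n := (\row_i tnth t i)%R.

Definition outer_Rn (A : set 'rV[R]_n) : \bar R :=
  ((@lebesgue_tuple R n)^*)%mu (row_of_tuple @^-1` A).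

Let outer_Rn0 : outer_Rn set0 = 0.
Proof. by rewrite /outer_Rn preimage_set0 outer_measure0. Qed.

Let outer_Rn_ge0 A : 0 <= outer_Rn A.
Proof. exact: outer_measure_ge0. Qed.

Let le_outer_Rn :
  {homo outer_Rn : A B / (A `<=` B)%classic >-> A <= B}.
Proof. by move=> A B AB; apply: le_outer_measure => t; exact: AB. Qed.

Let outer_Rn_sigma_subadditive : sigma_subadditive outer_Rn.
Proof.
move=> F; rewrite /outer_Rn preimage_bigcup.
exact: outer_measure_sigma_subadditive.
Qed.

HB.instance Definition _ := isOuterMeasure.Build R 'rV[R]_n outer_Rn
  outer_Rn0 outer_Rn_ge0 le_outer_Rn
  outer_Rn_sigma_subadditive.

(* n-dimensional Lebesgue outer measure *)
Definition lebesgue_outer : {outer_measure set 'rV[R]_n -> \bar R} := outer_Rn.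

End lebesgue_Rn.

(* Row vectors of length n carrying the sigma-algebra of all Lebesgue-measurable sets (those
   satisfying the Caratheodory criterion), which contains the Borel sets. *)
Notation Rn R n := (caratheodory_type (@lebesgue_outer R n)).

Definition lebesgue_Rn (R : realType) (n : nat) :
    {measure set (Rn R n) -> \bar R} :=
  (@lebesgue_outer R n : set (Rn R n) -> \bar R).

Lemma measurable_tuple_box (R : realType) (n : nat)
    (A : 'I_n -> set (measurableTypeR R)) : (forall i, measurable (A i)) ->
  measurable [set t : n.-tuple (measurableTypeR R) | forall i, A i (tnth t i)].
Proof.
move=> mA.
rewrite (_ : mkset _ = \bigcap_(i in [set: 'I_n]) ((@tnth n (measurableTypeR R))^~ i @^-1` A i)).
  apply: fin_bigcap_measurable => // i _.
  by rewrite -[X in measurable X]setTI; exact: measurable_tnth.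
by apply/seteqP; split => [t h i _|t h i] /=; [exact: h|exact: (h i)].
Qed.

Lemma lebesgue_tuple_box (R : realType) (n : nat)
    (A : 'I_n -> set (measurableTypeR R)) : (forall i, measurable (A i)) ->
  lebesgue_tuple R n [set t | forall i, A i (tnth t i)] =
  (\prod_(i < n) @lebesgue_measure R (A i))%E.
Proof.
elim: n A => [|n IH] A mA.
  rewrite big_ord0 /= diracE mem_set// => -[].
  by [].
rewrite big_ord_recl -IH; last by move=> i; exact: mA.
rewrite -product_measure1E//;
  last by apply: (@measurable_tuple_box R n (fun i => A (lift ord0 i))) => i; exact: mA.
rewrite /= /lebesgue_step /pushforward; congr (_ _).
apply/seteqP; split => -[x y] /=.
  move=> h; split; first exact: (h ord0).
  by move=> i; have := h (lift ord0 i); rewrite tnthS; congr (A _ _); congr tnth; apply/val_inj.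
move=> [h0 h] i.
have [j ->|->] := unliftP ord0 i; last exact: h0.
by rewrite tnthS; have := h j; congr (A _ _); congr tnth; apply/val_inj.
Qed.

Lemma lebesgue_Rn_box (R : realType) (n : nat)
    (A : 'I_n -> set (measurableTypeR R)) : (forall i, measurable (A i)) ->
  lebesgue_Rn R n [set x | forall i, A i (x 0 i)] =
  (\prod_(i < n) @lebesgue_measure R (A i))%E.
Proof.
move=> mA; rewrite -lebesgue_tuple_box//.
rewrite -(measurable_mu_extE _ (measurable_tuple_box mA)).
rewrite /lebesgue_Rn /= /outer_Rn; congr (_ _).
by apply/seteqP; split => t /= h i; have := h i; rewrite mxE.
Qed.

Section functions_on_Rn.
Context (R : realType) (n : nat).
Implicit Types f : 'rV[R]_n -> R.

Definition lebesgue_measurable f :=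
  @measurable_fun _ _ (Rn R n) (measurableTypeR R) setT f.

Definition integral_Rn f : \bar R :=
  (\int[@lebesgue_Rn R n]_x (f x)%:E)%E.

(* The library norm `|x| on row vectors is the sup norm. *)
Definition euclidean_norm (x : 'rV[R]_n) : R :=
  Num.sqrt (\sum_(i < n) x 0 i ^+ 2).

Definition radial f :=
  forall x y, euclidean_norm x = euclidean_norm y -> f x = f y.

Definition log_concave f :=
  forall (x y : 'rV[R]_n) (s : R), 0 < s < 1 ->
    f (s *: x + (1 - s) *: y) >= f x `^ s * f y `^ (1 - s).

End functions_on_Rn.

(* Main.v *)
Require Import Defs.
From mathcomp Require Import all_boot all_order all_algebra.
From mathcomp Require Import all_classical all_reals all_analysis.
From mathcomp Require Import measurable_realfun ring lra.

Import Order.TTheory GRing.Theory Num.Theory.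
Import numFieldNormedType.Exports.
Local Open Scope classical_set_scope.
Local Open Scope ring_scope.

(** Either form of log-concavity yields [f x ^ l * g y ^ (1 - l) <= h z] as soon
as [|z| <= l |x| + (1 - l) |y|]. Hence only the radii of the level sets matter,
and [f], [g] may be replaced from below by radially decreasing step functions.
Cut these into annuli carrying equal masses (the monotone transport): the i-th
annuli have volumes [du], [dv] and heights [phi], [gam] with
[phi du = gam dv], up to scaling [g] and [h]. In volume coordinates the map
[N (u, v) = (l u^(1/n) + (1 - l) v^(1/n))^n] is concave and 1-homogeneous, hence
superadditive, so the corresponding annulus of [h] has volume at least
[N (du, dv)], and the refined AM-GM inequality gives
[N (du, dv) >= du^l dv^(1 - l) (1 + c psi^2)] where [psi = 1 - min / max] of [du]
and [dv]. Summation bounds the average of [psi^2], thus that of [psi], and the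
average of [psi] controls the [L^1] norm of [(f - h)^+]: both the ratio of the
heights and the displacement of the radii are at most [psi], the latter after
an Abel summation over the levels. *)

(** * Refined means *)

Section real_inequalities.
Context {R : realType}.
Implicit Types a b l u v x y : R.

(** Filling in the level sets is the delicate point. When only [h] is log-concave, [f] need not
    decrease with the radius, so the balls of radius [level_radius f c] can carry a mass [A] larger
    than that of [f]. The bound on [A] comes from [h]: the coupling gives [A] at most the integral
    of the scaled [h], near-equality bounds that by [1 + e] times the geometric mean of the masses
    of [f] and of the scaled [g], and AM-GM turns this into [tau * (A - F) <= 3 * e * A]. Equal
    masses are used twice. Heights are inversely proportional to volumes, so a single disparity
    serves for both; and the geometric mean of the heights times that of the volumes is exactly the
    common mass, so the remainder in the refined AM-GM is pure gain. A one-sided estimate suffices: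
    a minorant [s] of [f] of almost full mass with [s <= h + D] almost everywhere forces [f] and [h]
    to be close in L1 once their masses are close. *)

Lemma powR_amgm l a b : 0 < l < 1 -> 0 <= a -> 0 <= b ->
  a `^ l * b `^ (1 - l) <= l * a + (1 - l) * b.
Proof.
move=> /andP[l0 l1] a0 b0.
have l1' : 0 < 1 - l by rewrite subr_gt0.
have := @conjugate_powR R (a `^ l) (b `^ (1 - l)) l^-1 (1 - l)^-1.
rewrite !powR_ge0 !invr_gt0 l0 l1' !invrK -!powRrM !divff ?gt_eqF//.
rewrite !powRr1// (mulrC a) (mulrC b); apply => //.
by rewrite addrC subrK.
Qed.

(* The Kittaneh-Manasrah refinement: when [l <= 1/2], subtracting
   [l * (sqrt a - sqrt b)^2] from the arithmetic mean of [a] and [b] leaves the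
   arithmetic mean of [sqrt (a * b)] and [b] with weights [2 l] and [1 - 2 l]. *)
Lemma powR_amgm_sqrt l a b : 0 < l < 1 -> 0 <= a -> 0 <= b ->
  a `^ l * b `^ (1 - l)
    + Num.min l (1 - l) * (Num.sqrt a - Num.sqrt b) ^+ 2
  <= l * a + (1 - l) * b.
Proof.
wlog lh : l a b / l <= 1 / 2 => [H l01 a0 b0|/andP[l0 l1] a0 b0].
  have [lh|lh] := leP l (1 / 2); first exact: H.
  have := H (1 - l) b a; rewrite subKr minC [X in X <= _ -> _]addrC.
  rewrite (mulrC (b `^ _)) (addrC ((1 - l) * _)) -(opprB (Num.sqrt a)) sqrrN.
  by rewrite addrC; apply => //; lra.
have -> : Num.min l (1 - l) = l by apply/min_idPl; lra.
have sa := sqr_sqrtr a0; have sb := sqr_sqrtr b0.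
have := sqrtr_ge0 a; have := sqrtr_ge0 b.
set s := Num.sqrt a in sa *; set t := Num.sqrt b in sb * => t0 s0.
(* At [l = 1/2] the weight [1 - 2 l] vanishes, outside the range of [powR_amgm]; the claim is then
   an identity. *)
have [lE|lne] := eqVneq l (1 / 2).
  have -> : 1 - l = 1 / 2 by rewrite lE; lra.
  by rewrite lE mul1r !powR12_sqrt// -/s -/t -sa -sb; nra.
have lt : 0 < 2 * l < 1 by lra.
have := powR_amgm _ (s * t) b lt (mulr_ge0 s0 t0) b0.
suff -> : (s * t) `^ (2 * l) * b `^ (1 - 2 * l) = a `^ l * b `^ (1 - l).
  by rewrite -sa -sb; nra.
rewrite powRM// !powRrM !powR_mulrn// sa sb -mulrA; congr (_ * _).
rewrite -powRD; last by apply/implyP => /eqP; lra.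
by congr (_ `^ _); lra.
Qed.

(** Being invariant under a common scaling and symmetric, it takes the same value on [phi], [gam] as
    on [du], [dv] when [phi du = gam dv]. *)
Definition disparity a b := 1 - Num.min a b / Num.max a b.

Lemma disparityC a b : disparity a b = disparity b a.
Proof. by rewrite /disparity minC maxC. Qed.

Lemma disparity_ge0 a b : 0 < a -> 0 < b -> 0 <= disparity a b.
Proof.
move=> a0 b0; rewrite subr_ge0 ler_pdivrMr ?mul1r ?lt_max ?a0//.
by rewrite ge_min !le_max lexx.
Qed.

Lemma disparity_le a b : 0 < a -> 0 < b -> a * (1 - disparity a b) <= Num.min a b.
Proof.
move=> a0 b0; rewrite /disparity subKr.
have M0 : 0 < Num.max a b by rewrite lt_max a0.
rewrite mulrA ler_pdivrMr// mulrC ler_wpM2l// ?le_max ?lexx//.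
by rewrite le_min !ltW.
Qed.

Lemma exprn_min n a b : 0 <= a -> 0 <= b ->
  Num.min (a ^+ n) (b ^+ n) = Num.min a b ^+ n.
Proof.
move=> a0 b0; have [ab|/ltW ab] := leP a b.
  by apply/min_idPl; rewrite lerXn2r.
by apply/min_idPr; rewrite lerXn2r.
Qed.

Lemma exprn_max n a b : 0 <= a -> 0 <= b ->
  Num.max (a ^+ n) (b ^+ n) = Num.max a b ^+ n.
Proof.
move=> a0 b0; have [ab|/ltW ab] := leP a b.
  by apply/max_idPr; rewrite lerXn2r.
by apply/max_idPl; rewrite lerXn2r.
Qed.

Lemma bernoulli_ineq n x : 0 <= x -> 1 + n%:R * (x - 1) <= x ^+ n.
Proof.
move=> x0; elim: n => [|n ih]; first by rewrite mul0r addr0 expr0.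
rewrite exprS -natr1; have := ler_wpM2l x0 ih; set y := x ^+ n.
have : 0 <= n%:R * (x - 1) ^+ 2 by rewrite mulr_ge0// sqr_ge0.
by set m : R := n%:R; nra.
Qed.

(** Bernoulli's inequality at [q = min / max] reads [1 - q ^+ n <= n * (1 - q)]. Squared, this loss
    between radii and volumes becomes the [n ^+ 2] of later constants. *)
Lemma disparity_exprn n a b : 0 < a -> 0 < b ->
  disparity (a ^+ n) (b ^+ n) <= n%:R * disparity a b.
Proof.
move=> /ltW a0 /ltW b0; rewrite /disparity exprn_min// exprn_max// -expr_div_n.
have : 0 <= Num.min a b / Num.max a b by rewrite divr_ge0// ?le_min ?le_max a0.
by set q := (_ / _) => /(bernoulli_ineq n); set w : R := n%:R; lra.
Qed.

(** Makes the additive remainder multiplicative: the geometric mean is at most [M = max a b], so it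
    suffices that [M * disparity ^+ 2] is at most four times the squared difference of the square
    roots. *)
Lemma powR_amgm_disparity l a b : 0 < l < 1 -> 0 < a -> 0 < b ->
  a `^ l * b `^ (1 - l) * (1 + Num.min l (1 - l) / 4 * disparity a b ^+ 2)
  <= l * a + (1 - l) * b.
Proof.
move=> l01 a0 b0; have [/andP[l0 l1]] := (l01, l01) => _.
apply: le_trans (powR_amgm_sqrt _ _ _ l01 (ltW a0) (ltW b0)).
have t0 : 0 <= Num.min l (1 - l) by rewrite le_min; lra.
set G := a `^ l * b `^ (1 - l).
rewrite mulrDr mulr1 lerD2l mulrCA -2!mulrA ler_wpM2l// mulrCA.
have GM : 0 <= G <= Num.max a b.
  rewrite mulr_ge0 ?powR_ge0//=; apply: (le_trans (powR_amgm _ _ _ l01 (ltW a0) (ltW b0))).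
  have : a <= Num.max a b by rewrite le_max lexx.
  have : b <= Num.max a b by rewrite le_max lexx orbT.
  by set M := Num.max a b; nra.
have H : Num.max a b * disparity a b ^+ 2 <= 4 * (Num.sqrt a - Num.sqrt b) ^+ 2.
  clear -a0 b0; wlog ab : a b a0 b0 / a <= b => [H|].
    have /orP[ab|ba] := le_total a b; first exact: H.
    by have := H b a b0 a0 ba; rewrite maxC disparityC -(opprB (Num.sqrt b)) sqrrN.
  rewrite /disparity (min_idPl ab) (max_idPr ab).
  have sa := sqr_sqrtr (ltW a0); have sb := sqr_sqrtr (ltW b0).
  have : 0 < Num.sqrt a by rewrite sqrtr_gt0.
  have : 0 < Num.sqrt b by rewrite sqrtr_gt0.
  have : Num.sqrt a <= Num.sqrt b by rewrite ler_wsqrtr.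
  set s := Num.sqrt a in sa *; set t := Num.sqrt b in sb * => st t0 s0.
  rewrite -sa -sb.
  (* The factor [1 + s / t] is at most [2], whence the constant [4]. *)
  have -> : t ^+ 2 * (1 - s ^+ 2 / t ^+ 2) ^+ 2
    = (t - s) ^+ 2 * ((1 + s / t) ^+ 2) by field; rewrite gt_eqF.
  rewrite -(opprB t) sqrrN mulrC ler_wpM2r ?sqr_ge0//.
  have : 0 <= s / t <= 1 by rewrite ler_pdivrMr// mul1r st divr_ge0// ltW.
  by set r := s / t; nra.
have D0 : 0 <= disparity a b ^+ 2 by rewrite sqr_ge0.
move: H D0 GM; set D := disparity a b ^+ 2; set Q := (_ - _) ^+ 2.
set M := Num.max a b => H D0 /andP[G0 GM].
have GD : G * D <= M * D by rewrite ler_wpM2r.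
rewrite [leLHS](_ : _ = G * D / 4); last by rewrite /G; ring.
by lra.
Qed.

Lemma powR_amgm_exprn n l a b : (0 < n)%N -> 0 < l < 1 -> 0 < a -> 0 < b ->
  (a ^+ n) `^ l * (b ^+ n) `^ (1 - l)
    * (1 + Num.min l (1 - l) / (4 * n%:R ^+ 2) * disparity (a ^+ n) (b ^+ n) ^+ 2)
  <= (l * a + (1 - l) * b) ^+ n.
Proof.
move=> n0 l01 a0 b0; have [/andP[l0 l1]] := (l01, l01) => _.
have t0 : 0 <= Num.min l (1 - l) by rewrite le_min; lra.
have H := powR_amgm_disparity _ _ _ l01 a0 b0.
have n0' : 0 < n%:R :> R by rewrite ltr0n.
set q := _ / 4 * _ in H.
have q0 : 0 <= q by rewrite /q mulr_ge0 ?sqr_ge0// divr_ge0.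
have : ((a `^ l * b `^ (1 - l)) * (1 + q)) ^+ n <= (l * a + (1 - l) * b) ^+ n.
  have qq : 0 <= 1 + q by lra.
  rewrite lerXn2r// nnegrE ?mulr_ge0 ?powR_ge0//.
  by have : 0 <= l * a + (1 - l) * b by nra.
apply: le_trans; rewrite !exprMn.
have powX u r : 0 < u -> (u `^ r) ^+ n = (u ^+ n) `^ r.
  move=> /ltW u0; rewrite -[LHS]powR_mulrn ?powR_ge0//.
  by rewrite -[u ^+ n](powR_mulrn n u0) powRAC.
rewrite !powX// ler_wpM2l// ?mulr_ge0 ?powR_ge0//.
have : 1 + q <= (1 + q) ^+ n.
  case: (n) n0 => // m _; rewrite exprS ler_peMr//; first by lra.
  by rewrite exprn_ege1//; lra.
apply: le_trans; rewrite lerD2l /q.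
rewrite invfM !mulrA -!mulrA ler_wpM2l// ler_wpM2l//.
rewrite -!expr2 mulrC ler_pdivrMr ?exprn_gt0// mulrC -exprMn.
rewrite lerXn2r ?nnegrE ?mulr_ge0 ?disparity_ge0 ?exprn_gt0//.
exact: disparity_exprn.
Qed.

(** In the induction step the two sides differ by [l (1 - l) (x - y) (x ^+ n - y ^+ n)], which is
    nonnegative by monotonicity of powers. *)
Lemma exprn_convex n l x y : 0 <= l <= 1 -> 0 <= x -> 0 <= y ->
  (l * x + (1 - l) * y) ^+ n <= l * x ^+ n + (1 - l) * y ^+ n.
Proof.
move=> /andP[l0 l1] x0 y0; elim: n => [|n ih]; first by rewrite !expr0; lra.
rewrite !exprS; have z0 : 0 <= l * x + (1 - l) * y by nra.
apply: le_trans (ler_wpM2l z0 ih) _.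
have : 0 <= (x - y) * (x ^+ n - y ^+ n).
  have [xy|/ltW xy] := leP x y.
    by rewrite mulr_le0// subr_le0// lerXn2r.
  by rewrite mulr_ge0// subr_ge0// lerXn2r.
set p := x ^+ n; set q := y ^+ n => pq.
have : 0 <= l * (1 - l) * ((x - y) * (p - q)) by rewrite mulr_ge0// mulr_ge0//; lra.
by nra.
Qed.

(* The triangle inequality for the l^n norm on R^2. *)
Lemma exprn_minkowski n l x y x' y' X Y : (0 < n)%N -> 0 < l < 1 ->
  0 <= x -> 0 <= y -> 0 <= x' -> 0 <= y' -> 0 <= X -> 0 <= Y ->
  X ^+ n = x ^+ n + x' ^+ n -> Y ^+ n = y ^+ n + y' ^+ n ->
  (l * x + (1 - l) * y) ^+ n + (l * x' + (1 - l) * y') ^+ n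
  <= (l * X + (1 - l) * Y) ^+ n.
Proof.
move=> n0 /andP[l0 l1] x0 y0 x'0 y'0 X0 Y0 XE YE.
have z0 u v w : 0 <= u -> 0 <= v -> 0 <= w -> w ^+ n = u ^+ n + v ^+ n ->
    (u <= w) * (v <= w).
  move=> u0 v0 w0 wE; split.
    by rewrite -(@ler_pXn2r _ n)// ?nnegrE// wE lerDl exprn_ge0.
  by rewrite -(@ler_pXn2r _ n)// ?nnegrE// wE lerDr exprn_ge0.
have [xX x'X] := z0 _ _ _ x0 x'0 X0 XE.
have [yY y'Y] := z0 _ _ _ y0 y'0 Y0 YE.
have [X00|Xn0] := eqVneq X 0.
  have [-> ->] : x = 0 /\ x' = 0 by split; lra.
  by rewrite X00 !mulr0 !add0r !exprMn YE mulrDr.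
have [Y00|Yn0] := eqVneq Y 0.
  have [-> ->] : y = 0 /\ y' = 0 by split; lra.
  by rewrite Y00 !mulr0 !addr0 !exprMn XE mulrDr.
have Xp : 0 < X by rewrite lt_neqAle eq_sym Xn0.
have Yp : 0 < Y by rewrite lt_neqAle eq_sym Yn0.
set Z := l * X + (1 - l) * Y.
have Zp : 0 < Z by rewrite /Z; nra.
(* After division by [Z], both sums are convex combinations with the same weights [m], [1 - m] of
   ratios to [X] and [Y]; the n-th powers of these ratios add up to [1] for each of [X] and [Y], so
   convexity concludes. *)
pose m := l * X / Z.
have m01 : 0 <= m <= 1.
  by rewrite /m ler_pdivrMr// divr_ge0 ?mulr_ge0 ?(ltW l0) ?(ltW Zp)//= mul1r /Z; nra.
have mE u v : (l * u + (1 - l) * v) / Z = m * (u / X) + (1 - m) * (v / Y).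
  by rewrite /m /Z; field; rewrite !gt_eqF.
rewrite -[leRHS]mul1r -ler_pdivrMr ?exprn_gt0// mulrDl -!expr_div_n !mE.
have X0' := ltW Xp; have Y0' := ltW Yp.
apply: le_trans (lerD (exprn_convex _ _ _ _ m01 _ _) (exprn_convex _ _ _ _ m01 _ _)) _;
  rewrite ?divr_ge0//.
have Xn : X ^+ n != 0 by rewrite expf_neq0.
have Yn : Y ^+ n != 0 by rewrite expf_neq0.
rewrite addrACA -!mulrDr !expr_div_n -!mulrDl -XE -YE !divff//.
by lra.
Qed.

End real_inequalities.

(** * Volumes of balls *)

Section lebesgue_scaling.
Context {R : realType}.
Local Open Scope classical_set_scope.
Local Open Scope ereal_scope.
Local Notation T n := (n.-tuple (measurableTypeR R)).
Local Notation leb := (@lebesgue_measure R).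

(** By uniqueness of the measure extending interval length: [c] times the image measure under
    multiplication by [c] has the right value on every []a, b]]. *)
Lemma lebesgue_measure_scale (c : R) (A : set (measurableTypeR R)) : (0 < c)%R ->
  measurable A -> leb (( *%R c) @^-1` A) = c^-1%:E * leb A.
Proof.
move=> c0 mA; have c1 : (0 <= c)%R by exact: ltW.
pose sc : measurableTypeR R -> measurableTypeR R := *%R c.
have mc : measurable_fun setT sc by exact: mulrl_measurable.
pose m0 : {measure set (measurableTypeR R) -> \bar R} := [the measure _ _ of pushforward leb sc].
pose m : {measure set (measurableTypeR R) -> \bar R} :=
  [the measure _ _ of mscale (NngNum c1) (m0 mc)].
have : forall X, ocitv X -> leb X = m X.
  move=> _ [[a b] _ <-] /=; rewrite /m /= /mscale /= /pushforward.
  rewrite (_ : _ @^-1` _ = `](a / c)%R, (b / c)%R]%classic); last first.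
    apply/seteqP; split => x /=; rewrite !in_itv/= ltr_pdivrMr// ler_pdivlMr//.
      by rewrite mulrC.
    by rewrite mulrC.
  rewrite !lebesgue_measure_itv/= !lte_fin ltr_pM2r ?invr_gt0//.
  case: ifPn => [ab|_]; last by rewrite mule0.
  by rewrite -!EFinB -EFinM -mulrBl mulrCA divff ?gt_eqF// mulr1.
move=> /lebesgue_measure_unique/(_ _ mA) ->; rewrite /m /= /mscale/= muleA -EFinM.
by rewrite mulVf ?gt_eqF// mul1e.
Qed.

Lemma ge0_integral_scale (c : R) (f : measurableTypeR R -> \bar R) : (0 < c)%R ->
  measurable_fun setT f -> (forall x, 0 <= f x) ->
  \int[leb]_x f (c * x)%R = c^-1%:E * \int[leb]_x f x.
Proof.
move=> c0 mf f0; have c1 : (0 <= c^-1)%R by rewrite invr_ge0 ltW.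
pose sc : measurableTypeR R -> measurableTypeR R := *%R c.
have mc : measurable_fun setT sc by exact: mulrl_measurable.
rewrite -(ge0_integral_mscale _ _ (NngNum c1))//.
have := @ge0_integral_pushforward _ _ _ _ R _ mc leb setT f measurableT mf.
rewrite preimage_setT => <- //.
apply: eq_measure_integral => A mA _.
by rewrite /mscale /= /pushforward lebesgue_measure_scale.
Qed.

Definition scale_tuple n (c : R) (t : T n) : T n := [tuple (c * tnth t i)%R | i < n].

(** Induction over the product structure: the section at [x] of the preimage is the preimage of the
    section at [c * x], so each coordinate contributes one factor [c^-1]. *)
Lemma lebesgue_tuple_scale n (c : R) (A : set (T n)) : (0 < c)%R -> measurable A ->
  lebesgue_tuple R n (scale_tuple n c @^-1` A) = (c^-1 ^+ n)%:E * lebesgue_tuple R n A.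
Proof.
move=> c0; elim: n A => [|n ih] A mA.
  rewrite expr0 mul1e /= !diracE; congr ((_ : bool)%:R%:E).
  rewrite (_ : _ @^-1` A = A)//; apply/seteqP; split => t /=;
    by rewrite (tuple0 t) (tuple0 (scale_tuple _ _ _)).
rewrite /= /lebesgue_step /pushforward.
have mt B : measurable B -> measurable (@tcons R n @^-1` B).
  by move=> mB; rewrite -[X in measurable X]setTI; exact: measurable_tcons.
rewrite /product_measure1.
under eq_integral => x _.
  rewrite /= (_ : xsection _ x =
      scale_tuple n c @^-1` (xsection (@tcons R n @^-1` A) (c * x)%R)); last first.
    apply/seteqP; split => t; rewrite /xsection /= !inE /=.
      congr (A _); apply: eq_from_tnth => i; rewrite tnth_mktuple.
      have [j ->|->] := unliftP ord0 i; rewrite /tcons ?tnthS ?tnth0//.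
      by rewrite /= tnth_mktuple; congr (_ * _)%R.
    congr (A _); apply: eq_from_tnth => i; rewrite tnth_mktuple.
    have [j ->|->] := unliftP ord0 i; rewrite /tcons ?tnthS ?tnth0//.
    by rewrite /= tnth_mktuple; congr (_ * _)%R.
  rewrite ih; last by apply: measurable_xsection; exact: mt.
  over.
have mphi : measurable_fun setT (fun x => lebesgue_tuple R n (xsection (@tcons R n @^-1` A) x)).
  by apply: measurable_fun_xsection; exact: mt.
rewrite ge0_integralZl//; first last.
- by rewrite lee_fin exprn_ge0// invr_ge0 ltW.
- apply: (measurableT_comp mphi); exact: mulrl_measurable.
rewrite (ge0_integral_scale c _ c0 mphi)//.
by rewrite muleA -EFinM exprSr.
Qed.

End lebesgue_scaling.

Section balls.
Context {R : realType} {n : nat}.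
Local Open Scope classical_set_scope.
Local Open Scope ereal_scope.
Local Notation T := (n.-tuple (measurableTypeR R)).

(** The outer measure on rows is pulled back along [row_of_tuple], and a Borel set of tuples splits
    every test set additively, in particular those coming from rows. *)
Lemma measurable_Rn (A : set 'rV[R]_n) :
  measurable ((@row_of_tuple R n) @^-1` A : set T) ->
  measurable (A : set (Rn R n)).
Proof.
move=> mA; have cA : caratheodory_measurable ((lebesgue_tuple R n)^*)%mu
    ((@row_of_tuple R n) @^-1` A).
  by apply: sub_caratheodory; exact: sub_sigma_algebra.
change (caratheodory_measurable (lebesgue_outer R n) A) => X.
exact: cA.
Qed.

Lemma lebesgue_RnE (A : set 'rV[R]_n) :
  measurable ((@row_of_tuple R n) @^-1` A : set T) ->
  lebesgue_Rn R n A = lebesgue_tuple R n ((@row_of_tuple R n) @^-1` A).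
Proof. by move=> mA; rewrite /lebesgue_Rn /= /outer_Rn measurable_mu_extE. Qed.

Local Notation norm := (@euclidean_norm R n).

Lemma measurable_norm_tuple :
  measurable_fun setT (norm \o @row_of_tuple R n : T -> measurableTypeR R).
Proof.
rewrite (_ : _ \o _ = @Num.sqrt R \o
    (fun t : T => (\sum_(i < n) (tnth t i : measurableTypeR R) ^+ 2)%R)).
  apply: measurableT_comp; first exact: continuous_measurable_fun (@sqrt_continuous R).
  apply: measurable_sum => i; apply: measurable_funX; exact: measurable_tnth.
apply/funext => t /=; rewrite /euclidean_norm; congr Num.sqrt.
by apply: eq_bigr => i _; rewrite mxE.
Qed.

Lemma measurable_euclidean_norm : lebesgue_measurable norm.
Proof.
move=> _ B mB; rewrite setTI; apply: measurable_Rn.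
rewrite -[X in measurable X]setTI -comp_preimage; exact: measurable_norm_tuple.
Qed.

Definition eball (r : R) : set 'rV[R]_n := [set x | (norm x < r)%R].

Lemma eball_tuple r : measurable ((@row_of_tuple R n) @^-1` eball r : set T).
Proof.
rewrite (_ : _ @^-1` _ = (norm \o @row_of_tuple R n) @^-1` `]-oo, r[).
  by rewrite -[X in measurable X]setTI; exact: measurable_norm_tuple.
by apply/seteqP; split => t /=; rewrite in_itv.
Qed.

Lemma measurable_eball r : measurable (eball r : set (Rn R n)).
Proof. by apply: measurable_Rn; exact: eball_tuple. Qed.

Lemma euclidean_norm_ge0 x : (0 <= norm x)%R. Proof. exact: sqrtr_ge0. Qed.

Lemma euclidean_normZ (c : R) x : norm (c *: x) = (`|c| * norm x)%R.
Proof.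
rewrite /euclidean_norm -sqrtr_sqr -sqrtrM ?sqr_ge0// mulr_sumr; congr Num.sqrt.
by apply: eq_bigr => i _; rewrite mxE exprMn.
Qed.

Lemma eball0 r : (r <= 0)%R -> eball r = set0.
Proof.
move=> r0; apply/seteqP; split => x //=; rewrite /eball /=.
by move=> /lt_le_trans/(_ r0); rewrite ltNge euclidean_norm_ge0.
Qed.

Lemma lebesgue_eball r : (0 < r)%R ->
  lebesgue_Rn R n (eball r) = (r ^+ n)%:E * lebesgue_Rn R n (eball 1).
Proof.
move=> r0; rewrite !lebesgue_RnE; [|exact: eball_tuple..].
have r1 : (0 < r^-1)%R by rewrite invr_gt0.
rewrite (_ : _ @^-1` eball r = scale_tuple n r^-1 @^-1` ((@row_of_tuple R n) @^-1` eball 1)).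
  by rewrite lebesgue_tuple_scale// ?invrK//; exact: eball_tuple.
apply/seteqP; rewrite /eball; split => t /=;
  (rewrite (_ : row_of_tuple (scale_tuple n r^-1 t) = r^-1 *: row_of_tuple t);
    [by rewrite euclidean_normZ gtr0_norm// mulrC ltr_pdivrMr// mul1r |
     by apply/rowP => i; rewrite !mxE tnth_mktuple]).
Qed.

Definition unit_ball_volume : R := fine (lebesgue_Rn R n (eball 1)).

Lemma norm_coord_le (x : 'rV[R]_n) i : (`|x 0 i| <= norm x)%R.
Proof.
rewrite -sqrtr_sqr ler_wsqrtr// (bigD1 i)//= lerDl sumr_ge0// => j _.
exact: sqr_ge0.
Qed.

Lemma lebesgue_unit_ball_fin : lebesgue_Rn R n (eball 1) < +oo.
Proof.
apply: (@le_lt_trans _ _ (lebesgue_Rn R n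
    [set x : 'rV[R]_n | forall i, `[(-1)%R, 1%R]%classic (x 0%R i)])).
  apply: le_outer_measure => x; rewrite /eball /= => x1 i.
  rewrite in_itv /= -ler_norml; exact: le_trans (norm_coord_le _ _) (ltW x1).
rewrite (@lebesgue_Rn_box R n (fun=> `[(-1)%R, 1%R]%classic))// lebesgue_measure_itv/=.
rewrite (eq_bigr (fun=> (1 - (-1))%R%:E)); first by rewrite prodEFin ltry.
by move=> i _; rewrite lte_fin ifT//; lra.
Qed.

Lemma lebesgue_unit_ball_gt0 : 0 < lebesgue_Rn R n (eball 1).
Proof.
(* Coordinates in []0, d]] have squares at most [d], with sum at most [n / (n + 1)]; the [n + 1]
   makes the bound strict. *)
pose d : R := (n.+1%:R^-1)%R.
have d0 : (0 < d)%R by rewrite invr_gt0.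
apply: (@lt_le_trans _ _ (lebesgue_Rn R n
    [set x : 'rV[R]_n | forall i, `]0%R, d]%classic (x 0%R i)])).
  rewrite (@lebesgue_Rn_box R n (fun=> `]0%R, d]%classic))// lebesgue_measure_itv/=.
  by rewrite lte_fin d0 -EFinB prodEFin lte_fin subr0 prodr_gt0.
apply: le_outer_measure => x; rewrite /eball /= => x1.
rewrite -[ltRHS]sqrtr1 ltr_sqrt// (@le_lt_trans _ _ (\sum_(i < n) d)%R)//.
  apply: ler_sum => i _; have := x1 i; rewrite in_itv/= => /andP[x0 xd].
  have d1 : (d <= 1)%R by rewrite invf_le1// ler1n.
  apply: (le_trans _ xd); rewrite expr2 ler_piMl// ?(ltW x0)//.
  exact: (le_trans xd d1).
rewrite sumr_const card_ord -mulr_natl /d ltr_pdivrMr// mul1r ltr_nat.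
by rewrite ltnS.
Qed.

Lemma unit_ball_volume_gt0 : (0 < unit_ball_volume)%R.
Proof. by rewrite fine_gt0// lebesgue_unit_ball_gt0 lebesgue_unit_ball_fin. Qed.

Lemma lebesgue_eballE r : (0 < n)%N -> (0 <= r)%R ->
  lebesgue_Rn R n (eball r) = (unit_ball_volume * r ^+ n)%:E.
Proof.
move=> n0; rewrite le_eqVlt => /predU1P[<-|r0].
  by rewrite eball0// measure0 expr0n gtn_eqF// mulr0.
rewrite lebesgue_eball// mulrC EFinM fineK//.
by rewrite ge0_fin_numE// lebesgue_unit_ball_fin.
Qed.

(** Sphere and open ball of radius [r] are disjoint subsets of the ball of any radius [s > r], so
    the sphere has measure at most [V (s ^+ n - r ^+ n)], which tends to [0] as [s] tends to [r]. *)
Lemma lebesgue_sphere r : (0 < n)%N -> lebesgue_Rn R n [set x | norm x = r] = 0.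
Proof.
move=> n0; set S := [set x | _].
have [r0|r0] := ltP r 0%R.
  rewrite (_ : S = set0) ?measure0//; apply/seteqP; split => // x /= xr.
  by move: r0; rewrite -xr ltNge euclidean_norm_ge0.
have mS : measurable (S : set (Rn R n)).
  rewrite (_ : S = norm @^-1` [set r]).
    by rewrite -[X in measurable X]setTI; exact: measurable_euclidean_norm.
  by [].
apply/eqP; rewrite eq_le measure_ge0 andbT; apply/lee_addgt0Pr => e e0.
rewrite add0e.
have V0 := unit_ball_volume_gt0.
have : (unit_ball_volume * s ^+ n)%R @[s --> r] --> (unit_ball_volume * r ^+ n)%R.
  by apply: cvgMr; exact: exprn_continuous.
move=> /cvgrPdist_lt/(_ _ e0) Hs.
have [s [rs se]] : exists s, (r < s)%R /\
    (unit_ball_volume * s ^+ n < unit_ball_volume * r ^+ n + e)%R.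
  near r^'+ => s; exists s; split; first by near: s; exact: nbhs_right_gt.
  have : (`|unit_ball_volume * r ^+ n - unit_ball_volume * s ^+ n| < e)%R.
    by near: s; exact: (cvg_within _ Hs).
  by rewrite ltr_norml => /andP[]; lra.
have : lebesgue_Rn R n (S `|` eball r) <= lebesgue_Rn R n (eball s).
  by apply: le_outer_measure => x; rewrite /eball/= => -[->//|/lt_trans]; exact.
have -> : lebesgue_Rn R n (S `|` eball r) = lebesgue_Rn R n S + lebesgue_Rn R n (eball r).
  apply: measureU => //; first exact: measurable_eball.
  by apply/seteqP; split => // x [/= xr]; rewrite /eball/= xr ltxx.
rewrite (lebesgue_eballE r n0 r0) (lebesgue_eballE s n0 (le_trans r0 (ltW rs))).
rewrite -leeBrDr// -EFinB => /le_trans; apply; rewrite lee_fin.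
by rewrite lerBlDr addrC ltW.
Unshelve. all: by end_near. Qed.

End balls.

(** * Integrals of radial step functions *)

Section integral_Rn_theory.
Context {R : realType} {n : nat}.
Implicit Types f g : 'rV[R]_n -> R.

Lemma measurable_EFin_Rn f : lebesgue_measurable f ->
  measurable_fun setT (fun x : Rn R n => (f x)%:E).
Proof. by move=> mf; apply/measurable_EFinP; exact: mf. Qed.

Lemma lebesgue_measurableD f g : lebesgue_measurable f ->
  lebesgue_measurable g -> lebesgue_measurable (fun x => f x + g x).
Proof. by move=> mf mg; apply: measurable_funD; [exact: mf|exact: mg]. Qed.

Lemma lebesgue_measurableZ (k : R) f : lebesgue_measurable f ->
  lebesgue_measurable (fun x => k * f x).
Proof.
by move=> mf; apply: measurable_funM; [exact: measurable_cst|exact: mf].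
Qed.

Lemma lebesgue_measurable_dist f g : lebesgue_measurable f ->
  lebesgue_measurable g -> lebesgue_measurable (fun x => `|f x - g x|).
Proof.
move=> mf mg; apply: measurableT_comp; first exact: normr_measurable.
by apply: measurable_funB; [exact: mf|exact: mg].
Qed.

Lemma integral_Rn_ge0 f : (forall x, 0 <= f x) -> (0 <= integral_Rn f)%E.
Proof. by move=> f0; apply: integral_ge0 => x _; rewrite lee_fin. Qed.

Lemma eq_integral_Rn f g : f =1 g -> integral_Rn f = integral_Rn g.
Proof. by move=> fg; congr integral_Rn; exact/funext. Qed.

Lemma integral_RnD f g : (forall x, 0 <= f x) -> (forall x, 0 <= g x) ->
  lebesgue_measurable f -> lebesgue_measurable g ->
  integral_Rn (fun x => f x + g x) = (integral_Rn f + integral_Rn g)%E.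
Proof.
move=> f0 g0 mf mg; rewrite /integral_Rn -ge0_integralD.
- by [].
- exact: measurableT.
- by move=> x _; rewrite lee_fin.
- exact: measurable_EFin_Rn.
- by move=> x _; rewrite lee_fin.
- exact: measurable_EFin_Rn.
Qed.

Lemma integral_RnZ (k : R) f : 0 <= k -> (forall x, 0 <= f x) ->
  lebesgue_measurable f ->
  integral_Rn (fun x => k * f x) = (k%:E * integral_Rn f)%E.
Proof.
move=> k0 f0 mf; rewrite /integral_Rn -ge0_integralZl_EFin.
- by [].
- exact: measurableT.
- by move=> x _; rewrite lee_fin.
- exact: measurable_EFin_Rn.
- exact: k0.
Qed.

(** The exceptional set absorbs the finitely many spheres whose radius is a level radius, where the
    comparison with half-open annuli can fail. *)
Lemma ae_le_integral_Rn f g (N : set 'rV[R]_n) :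
  (forall x, 0 <= f x) -> (forall x, 0 <= g x) ->
  lebesgue_measurable f -> lebesgue_measurable g ->
  measurable (N : set (Rn R n)) -> lebesgue_Rn R n N = 0%E ->
  (forall x, ~ N x -> f x <= g x) -> (integral_Rn f <= integral_Rn g)%E.
Proof.
move=> f0 g0 mf mg mN N0 fg; apply: ae_ge0_le_integral.
- exact: measurableT.
- by move=> x _; rewrite lee_fin.
- exact: measurable_EFin_Rn.
- by move=> x _; rewrite lee_fin.
- exact: measurable_EFin_Rn.
- exists N; split; [exact: mN|exact: N0|move=> x /= H].
  by apply: contrapT => Nx; apply: H => _; rewrite lee_fin fg.
Qed.

Lemma le_integral_Rn f g :
  (forall x, 0 <= f x) -> (forall x, 0 <= g x) ->
  lebesgue_measurable f -> lebesgue_measurable g ->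
  (forall x, f x <= g x) -> (integral_Rn f <= integral_Rn g)%E.
Proof.
move=> f0 g0 mf mg fg; apply: (@ae_le_integral_Rn _ _ set0) => //.
Qed.

End integral_Rn_theory.

Section shells.
Context {R : realType} {n : nat}.
Local Notation norm := (@euclidean_norm R n).
Local Notation V := (@unit_ball_volume R n).
Implicit Types (c a b : nat -> R) (x : 'rV[R]_n).

(** The shells may overlap, as they do in the second summand of [gap] below. *)
Definition shells c a b m x : R :=
  \sum_(i < m) c i * (a i <= norm x < b i)%R%:R.

Lemma shells_ge0 c a b m x : (forall i, (i < m)%N -> 0 <= c i) ->
  0 <= shells c a b m x.
Proof. by move=> c0; apply: sumr_ge0 => i _; rewrite mulr_ge0 ?c0. Qed.

Lemma shell_indic (a b : R) :
  (fun x => (a <= norm x < b)%R%:R) = \1_(norm @^-1` `[a, b[) :> ('rV[R]_n -> R).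
Proof.
apply/funext => x; rewrite indicE; congr (nat_of_bool _)%:R.
by apply/idP/idP; rewrite inE /= in_itv.
Qed.

Lemma measurable_shell (a b : R) :
  measurable (norm @^-1` `[a, b[ : set (Rn R n)).
Proof.
rewrite -[X in measurable X]setTI; exact: measurable_euclidean_norm.
Qed.

Lemma measurable_shells c a b m : lebesgue_measurable (shells c a b m).
Proof.
apply: measurable_sum => i; apply: measurable_funM; first exact: measurable_cst.
rewrite shell_indic; apply: measurable_indic; exact: measurable_shell.
Qed.

Lemma lebesgue_shell (a b : R) : (0 < n)%N -> 0 <= a <= b ->
  lebesgue_Rn R n (norm @^-1` `[a, b[%classic) = (V * (b ^+ n - a ^+ n))%:E.
Proof.
move=> n0 /andP[a0 ab].
have fb : (lebesgue_Rn R n (eball b) < +oo)%E.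
  by rewrite (lebesgue_eballE b n0 (le_trans a0 ab)) ltry.
have -> : (norm @^-1` `[a, b[ = eball b `\` eball a)%classic.
  apply/seteqP; split => x; rewrite /= in_itv /eball /=.
    by move=> /andP[ax ->]; split => //; apply/negP; rewrite -leNgt.
  by move=> [-> /negP]; rewrite -leNgt => ->.
have -> : lebesgue_Rn R n (eball b `\` eball a)%classic =
    (lebesgue_Rn R n (eball b) - lebesgue_Rn R n (eball b `&` eball a)%classic)%E.
  apply: measureD; [exact: measurable_eball..|exact: fb].
rewrite (_ : (eball b `&` eball a)%classic = eball a); last first.
  by apply/seteqP; split => x [] //=; rewrite /eball /= => xa; split => //; exact: lt_le_trans ab.
rewrite (lebesgue_eballE b n0 (le_trans a0 ab)) (lebesgue_eballE a n0 a0).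
by rewrite -EFinB mulrBr.
Qed.

Lemma integral_shell (a b : R) : (0 < n)%N -> 0 <= a <= b ->
  integral_Rn (fun x => (a <= norm x < b)%R%:R) = (V * (b ^+ n - a ^+ n))%:E.
Proof.
move=> n0 ab; rewrite shell_indic /integral_Rn.
rewrite integral_indic; [|exact: measurableT|exact: measurable_shell].
by rewrite setIT lebesgue_shell.
Qed.

Lemma integral_shells c a b m : (0 < n)%N -> (forall i, (i < m)%N -> 0 <= c i) ->
  (forall i, (i < m)%N -> 0 <= a i <= b i) ->
  integral_Rn (shells c a b m) = (V * \sum_(i < m) c i * (b i ^+ n - a i ^+ n))%:E.
Proof.
move=> n0; elim: m => [|m ih] c0 ab.
  rewrite big_ord0 mulr0 (@eq_integral_Rn _ _ _ (cst 0)).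
    by rewrite /integral_Rn integral0.
  by move=> x; rewrite /shells big_ord0.
rewrite (@eq_integral_Rn _ _ _ (fun x =>
  shells c a b m x + c m * (a m <= norm x < b m)%R%:R)); last first.
  by move=> x; rewrite /shells big_ord_recr.
have c0' i : (i < m)%N -> 0 <= c i by move=> im; rewrite c0// ltnW.
have mS : lebesgue_measurable (fun x => (a m <= norm x < b m)%R%:R : R).
  rewrite shell_indic; apply: measurable_indic; exact: measurable_shell.
rewrite integral_RnD; first last.
- exact: lebesgue_measurableZ.
- exact: measurable_shells.
- by move=> x; rewrite mulr_ge0 ?c0.
- by move=> x; exact: shells_ge0.
rewrite ih//; last by move=> i im; rewrite ab// ltnW.
rewrite integral_RnZ ?c0// integral_shell ?ab//.
by rewrite -EFinM -EFinD; congr EFin; rewrite big_ord_recr/=; ring.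
Qed.

End shells.

Section annuli.
Context {R : realType} {n : nat}.
Local Notation norm := (@euclidean_norm R n).
Implicit Types (c rho : nat -> R) (x : 'rV[R]_n).

Definition annuli c rho m x := shells c rho (rho \o succn) m x.

Lemma annuliE c rho m x : (forall i, (i < m)%N -> rho i <= rho i.+1) ->
  annuli c rho m x =
  \sum_(i < m) c i * ((norm x < rho i.+1)%R%:R - (norm x < rho i)%R%:R).
Proof.
move=> rho1; apply: eq_bigr => i _; congr (_ * _) => /=.
have [xr|xr] /= := leP (rho i) (norm x); first by rewrite subr0.
by rewrite (lt_le_trans xr (rho1 _ _))// subrr.
Qed.

Lemma sum_ball_indic rho m x : rho 0%N = 0 ->
  \sum_(i < m) ((norm x < rho i.+1)%R%:R - (norm x < rho i)%R%:R) = (norm x < rho m)%R%:R :> R.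
Proof.
move=> rho0.
rewrite -(big_mkord xpredT (fun i =>
  (norm x < rho i.+1)%R%:R - (norm x < rho i)%R%:R)).
by rewrite telescope_sumr// rho0 (ltNge _ 0) sqrtr_ge0 subr0.
Qed.

(** The differences of ball indicators are nonnegative and telescope to at most [1]. The hypothesis
    is stated on balls because lower bounds for [h] come in that form. *)
Lemma annuli_le c rho m x (y : R) : rho 0%N = 0 -> 0 <= y ->
  (forall i, (i < m)%N -> rho i <= rho i.+1) ->
  (forall i, (i < m)%N -> norm x < rho i.+1 -> c i <= y) ->
  annuli c rho m x <= y.
Proof.
move=> rho0 y0 rho1 cy; rewrite annuliE//.
apply: (@le_trans _ _ (\sum_(i < m) y * ((norm x < rho i.+1)%R%:R - (norm x < rho i)%R%:R))).
  apply: ler_sum => i _; have [xr|xr] := ltP (norm x) (rho i.+1).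
    by rewrite ler_wpM2r ?cy// subr_ge0 lern1 leq_b1.
  by rewrite ltNge (le_trans (rho1 _ (ltn_ord i)) xr) subrr !mulr0.
by rewrite -mulr_sumr sum_ball_indic// ler_piMr// lern1 leq_b1.
Qed.

(** The annuli up to index [i] have heights at least [c i] and indicators telescoping to that of a
    ball containing [x]; the others only add. *)
Lemma annuli_ge c rho m x i : rho 0%N = 0 -> (i < m)%N ->
  (forall i, (i < m)%N -> rho i <= rho i.+1) ->
  (forall i, (i < m)%N -> 0 <= c i) ->
  (forall i j, (i <= j < m)%N -> c j <= c i) ->
  norm x < rho i.+1 -> c i <= annuli c rho m x.
Proof.
move=> rho0 im rho1 c0 c1 xr; rewrite annuliE//.
have D0 j : (j < m)%N -> 0 <= (norm x < rho j.+1)%R%:R - (norm x < rho j)%R%:R :> R.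
  move=> jm; rewrite subr_ge0 ler_nat; have [xj|//] := ltP (norm x) (rho j).
  by rewrite (lt_le_trans xj (rho1 _ jm)).
rewrite -(big_mkord xpredT (fun j => c j * ((norm x < rho j.+1)%R%:R - (norm x < rho j)%R%:R))).
rewrite (big_cat_nat _ (n := i.+1))//= -[leLHS]addr0 lerD//; last first.
  by rewrite big_nat; apply: sumr_ge0 => j /andP[_ jm]; rewrite mulr_ge0 ?c0 ?D0.
rewrite big_mkord (@le_trans _ _ (\sum_(j < i.+1)
  c i * ((norm x < rho j.+1)%R%:R - (norm x < rho j)%R%:R)))//.
  by rewrite -mulr_sumr sum_ball_indic// xr mulr1.
apply: ler_sum => j _; rewrite ler_wpM2r ?D0 ?c1//; last first.
  by rewrite -ltnS ltn_ord.
exact: leq_trans (ltn_ord j) im.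
Qed.

End annuli.

(** Serves with ball indicators for [a], giving the layer-cake form of a step function, and with
    volume displacements for [a]. *)
Lemma abel_sum (R : pzRingType) (k a : nat -> R) m : a 0%N = 0 ->
  \sum_(i < m) (k i - k i.+1) * a i.+1 + k m * a m =
  \sum_(i < m) k i * (a i.+1 - a i).
Proof.
move=> a0; elim: m => [|m ih]; first by rewrite !big_ord0 a0 mulr0 addr0.
by rewrite !big_ord_recr/= -ih mulrBr mulrBl -addrA subrK -addrA [_ + (_ - _)]addrC subrK.
Qed.

(** * Coupled annuli *)

Section nth_root.
Context {R : realType} (n : nat) (n0 : (0 < n)%N).
Implicit Types u v r : R.

Definition nth_root u : R := u `^ n%:R^-1.

Let n1 : n%:R != 0 :> R. Proof. by rewrite pnatr_eq0 -lt0n. Qed.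

Lemma nth_root0 : nth_root 0 = 0.
Proof. by rewrite /nth_root powR0// invr_neq0. Qed.

Lemma nth_root_ge0 u : 0 <= nth_root u. Proof. exact: powR_ge0. Qed.

Lemma nth_rootK u : 0 <= u -> nth_root u ^+ n = u.
Proof.
by move=> u0; rewrite -powR_mulrn ?powR_ge0// -powRrM mulVf// powRr1.
Qed.

Lemma exprn_nth_root r : 0 <= r -> nth_root (r ^+ n) = r.
Proof.
by move=> r0; rewrite /nth_root -(powR_mulrn n r0) -powRrM divff// powRr1.
Qed.

Lemma nth_root_lt u v : 0 <= u -> u < v -> nth_root u < nth_root v.
Proof.
move=> u0 uv; rewrite -(@ltr_pXn2r _ n)// ?nnegrE ?nth_root_ge0//.
by rewrite !nth_rootK// (le_trans u0)// ltW.
Qed.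

Lemma nth_root_le u r : 0 <= u -> 0 <= r -> u <= r ^+ n -> nth_root u <= r.
Proof.
move=> u0 r0 ur; rewrite -(@ler_pXn2r _ n)// ?nnegrE ?nth_root_ge0//.
by rewrite nth_rootK.
Qed.

End nth_root.

(** * Volume of an annulus with averaged radii *)

Section shell_growth.
Context {R : realType} (n : nat) (l a b c d : R).
Hypotheses (n0 : (0 < n)%N) (l01 : 0 < l < 1).
Hypotheses (ab : 0 <= a < b) (cd : 0 <= c < d).
Let P := b ^+ n - a ^+ n.
Let Q := d ^+ n - c ^+ n.
Let D := (l * b + (1 - l) * d) ^+ n - (l * a + (1 - l) * c) ^+ n.

Let P0 : 0 < P.
Proof. by case/andP: ab => a0 h; rewrite subr_gt0 ltrXn2r -?lt0n// nnegrE. Qed.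

Let Q0 : 0 < Q.
Proof. by case/andP: cd => c0 h; rewrite subr_gt0 ltrXn2r -?lt0n// nnegrE. Qed.

(** Superadditivity of [N], written in radii: [b ^+ n = a ^+ n + p ^+ n] and
    [d ^+ n = c ^+ n + q ^+ n]. *)
Let growth (p q : R) : 0 < p -> 0 < q -> p ^+ n = P -> q ^+ n = Q ->
  (l * p + (1 - l) * q) ^+ n <= D.
Proof.
move=> p0 q0 pP qQ; case/andP: ab => a0 h; case/andP: cd => c0 h'.
rewrite /D lerBrDl; apply: exprn_minkowski => //; try exact: ltW.
- exact: le_trans (ltW h).
- exact: le_trans (ltW h').
- by rewrite pP addrC subrK.
- by rewrite qQ addrC subrK.
Qed.

Let root (z : R) : 0 < z -> exists2 p, 0 < p & p ^+ n = z.
Proof.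
by move=> z0; exists (nth_root n z); [exact: powR_gt0|exact/nth_rootK/ltW].
Qed.

Lemma shell_growth :
  P `^ l * Q `^ (1 - l) * (1 + Num.min l (1 - l) / (4 * n%:R ^+ 2) * disparity P Q ^+ 2)
  <= D.
Proof.
have [[p p0 pP] [q q0 qQ]] := (root _ P0, root _ Q0).
apply: le_trans (growth p q p0 q0 pP qQ); rewrite -pP -qQ.
exact: powR_amgm_exprn.
Qed.

(** The cruder companion of [shell_growth]: that one controls masses, this one the displacement of
    radii. *)
Lemma shell_growth_min : Num.min P Q <= D.
Proof.
have [[p p0 pP] [q q0 qQ]] := (root _ P0, root _ Q0).
apply: le_trans (growth p q p0 q0 pP qQ); rewrite -pP -qQ (exprn_min _ _ _ (ltW p0) (ltW q0)).
have m0 : 0 <= Num.min p q by rewrite le_min !ltW.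
have /andP[l0 l1] := l01.
have mp : Num.min p q <= p by rewrite ge_min lexx.
have mq : Num.min p q <= q by rewrite ge_min lexx orbT.
move: m0 mp mq; set k := Num.min p q => m0 mp mq.
apply: lerXn2r; rewrite ?nnegrE//; nra.
Qed.

End shell_growth.

Lemma powR_ge_min (R : realType) (l a b : R) : 0 < l < 1 -> 0 < a -> 0 < b ->
  Num.min a b <= a `^ l * b `^ (1 - l).
Proof.
move=> /andP[l0 l1] a0 b0; have m0 : 0 < Num.min a b by rewrite lt_min a0.
have -> : Num.min a b = Num.min a b `^ l * Num.min a b `^ (1 - l).
  rewrite -powRD; last by apply/implyP => _; rewrite gt_eqF.
  by rewrite addrC subrK powRr1// ltW.
have l0' := ltW l0; have l1' : 0 <= 1 - l by rewrite subr_ge0 ltW.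
have [a0' [b0' m0']] := (ltW a0, (ltW b0, ltW m0)).
by rewrite ler_pM ?powR_ge0// ge0_ler_powR ?nnegrE// ge_min lexx ?orbT.
Qed.

Section coupled_annuli.
Context {R : realType} {n : nat} (l : R) (m : nat) (phi gam x y : nat -> R).
Hypotheses (n0 : (0 < n)%N) (l01 : 0 < l < 1).
Hypotheses (phi0 : forall i, (i < m)%N -> 0 < phi i) (phim : phi m = 0).
Hypotheses (gam0 : forall i, (i < m)%N -> 0 < gam i).
Hypothesis phi1 : forall i j, (i <= j < m)%N -> phi j <= phi i.
Hypothesis gam1 : forall i j, (i <= j < m)%N -> gam j <= gam i.
Hypotheses (x0 : x 0%N = 0) (x1 : forall i, (i < m)%N -> x i < x i.+1).
Hypotheses (y0 : y 0%N = 0) (y1 : forall i, (i < m)%N -> y i < y i.+1).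
Hypothesis mass : forall i, (i < m)%N ->
  phi i * (x i.+1 ^+ n - x i ^+ n) = gam i * (y i.+1 ^+ n - y i ^+ n).

Let du i := x i.+1 ^+ n - x i ^+ n.
Let dv i := y i.+1 ^+ n - y i ^+ n.
Let M i := l * x i + (1 - l) * y i.
Let eta i := phi i `^ l * gam i `^ (1 - l).
(** Capping [eta] at [phi] keeps [phi - kap] nonnegative, while [kap] still decreases and still
    bounds [h] from below on the balls of radius [M i.+1]. *)
Let kap i := Num.min (phi i) (eta i).
Let psi i := disparity (du i) (dv i).
Local Notation V := (@unit_ball_volume R n).
Let A := V * \sum_(i < m) phi i * du i.
Let c := Num.min l (1 - l) / (4 * n%:R ^+ 2).

Lemma incr_ge0 (z : nat -> R) i : z 0%N = 0 -> (forall i, (i < m)%N -> z i < z i.+1) ->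
  (i <= m)%N -> 0 <= z i.
Proof.
move=> z0 z1; elim: i => [|i ih im]; first by rewrite z0.
exact: le_trans (ih (ltnW im)) (ltW (z1 _ im)).
Qed.

Let V0 : 0 < V. Proof. exact: unit_ball_volume_gt0. Qed.

Let xx i : (i < m)%N -> 0 <= x i < x i.+1.
Proof. by move=> im; rewrite x1// andbT incr_ge0// ltnW. Qed.

Let yy i : (i < m)%N -> 0 <= y i < y i.+1.
Proof. by move=> im; rewrite y1// andbT incr_ge0// ltnW. Qed.

Let du0 i : (i < m)%N -> 0 < du i.
Proof.
move=> im; have /andP[h h'] := xx i im.
by rewrite subr_gt0 ltrXn2r -?lt0n// nnegrE// (le_trans h)// ltW.
Qed.

Let dv0 i : (i < m)%N -> 0 < dv i.
Proof.
move=> im; have /andP[h h'] := yy i im.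
by rewrite subr_gt0 ltrXn2r -?lt0n// nnegrE// (le_trans h)// ltW.
Qed.

Let p i := phi i * du i.

Let phi_ge0 i : (i < m)%N -> 0 <= phi i. Proof. by move=> im; rewrite ltW ?phi0. Qed.
Let gam_ge0 i : (i < m)%N -> 0 <= gam i. Proof. by move=> im; rewrite ltW ?gam0. Qed.
Let du_ge0 i : (i < m)%N -> 0 <= du i. Proof. by move=> im; rewrite ltW ?du0. Qed.
Let dv_ge0 i : (i < m)%N -> 0 <= dv i. Proof. by move=> im; rewrite ltW ?dv0. Qed.
Let V_ge0 : 0 <= V. Proof. exact: ltW. Qed.

Let p0 i : (i < m)%N -> 0 < p i.
Proof. by move=> im; rewrite mulr_gt0 ?phi0 ?du0. Qed.

Let p_ge0 i : (i < m)%N -> 0 <= p i. Proof. by move=> im; rewrite ltW ?p0. Qed.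

Let psi0 i : (i < m)%N -> 0 <= psi i.
Proof. by move=> im; rewrite disparity_ge0 ?du0 ?dv0. Qed.

(** Since [phi du = gam dv = p], the product of the two geometric means is
    [p ^ l * p ^ (1 - l) = p]; [shell_growth] supplies the rest. *)
Let eta_dN i : (i < m)%N ->
  p i * (1 + c * psi i ^+ 2) <= eta i * (M i.+1 ^+ n - M i ^+ n).
Proof.
move=> im; have := shell_growth n l _ _ _ _ n0 l01 (xx i im) (yy i im).
rewrite -/(du i) -/(dv i) -/c -/(psi i) -/(M i) -/(M i.+1).
have e0 : 0 <= eta i by rewrite mulr_ge0 ?powR_ge0.
have E : eta i * (du i `^ l * dv i `^ (1 - l)) = p i.
  rewrite /eta mulrACA -!powRM ?phi_ge0 ?gam_ge0 ?du_ge0 ?dv_ge0//.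
  rewrite -(mass i im) -/(du i) -/(p i) -powRD; last first.
    by apply/implyP => _; rewrite gt_eqF ?p0.
  by rewrite addrC subrK powRr1 ?p_ge0.
by move=> /(ler_wpM2l e0); apply: le_trans; rewrite (mulrA (eta i)) E.
Qed.

(** A geometric mean is at least the minimum, and equal masses give [gam / phi = du / dv], which is
    at least [1 - psi]. *)
Let kap_ge i : (i < m)%N -> phi i * (1 - psi i) <= kap i.
Proof.
move=> im; rewrite /kap le_min; apply/andP; split.
  by rewrite ler_piMr ?phi_ge0// lerBlDr lerDl psi0.
apply: (@le_trans _ _ (Num.min (phi i) (gam i))); last first.
  exact: powR_ge_min l01 (phi0 _ im) (gam0 _ im).
rewrite le_min; apply/andP; split.
  by rewrite ler_piMr ?phi_ge0// lerBlDr lerDl psi0.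
rewrite -(ler_pM2r (dv0 i im)) -(mass i im) -mulrA ler_wpM2l ?phi_ge0//.
rewrite /psi disparityC mulrC; apply: le_trans (disparity_le _ _ (dv0 i im) (du0 i im)) _.
by rewrite ge_min lexx orbT.
Qed.

Let kap0 i : (i < m)%N -> 0 <= kap i.
Proof. by move=> im; rewrite le_min ltW ?phi0// mulr_ge0 ?powR_ge0. Qed.

(** The convention [phi m = 0] serves here: Abel summation then has no boundary term. *)
Let kapm : kap m = 0.
Proof. by rewrite /kap phim; apply/min_idPl; rewrite mulr_ge0 ?powR_ge0. Qed.

Let kap1 i : (i < m)%N -> kap i.+1 <= kap i.
Proof.
move=> im; have [im1|] := ltnP i.+1 m; last first.
  move=> mi; have -> : i.+1 = m by apply/eqP; rewrite eqn_leq im mi.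
  by rewrite kapm kap0.
rewrite /kap le_min !ge_min phi1 ?leqnSn//=; apply/orP; right.
have /andP[l0 l1] := l01.
have l0' := ltW l0; have l1' : 0 <= 1 - l by rewrite subr_ge0 ltW.
by rewrite ler_pM ?powR_ge0// ge0_ler_powR ?nnegrE ?phi_ge0 ?gam_ge0 ?phi1 ?gam1 ?leqnSn.
Qed.

Let MM i : (i < m)%N -> M i <= M i.+1.
Proof.
move=> im; have /andP[l0 l1] := l01.
have := x1 _ im; have := y1 _ im; rewrite /M; nra.
Qed.

Let M0 i : (i <= m)%N -> 0 <= M i.
Proof.
move=> im; have /andP[l0 l1] := l01.
have := incr_ge0 x i x0 x1 im; have := incr_ge0 y i y0 y1 im; rewrite /M; nra.
Qed.

(** Only a shortfall of [M] below [x] costs anything, so the radius is capped at [x]. *)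
Let min_M i := Num.min (M i) (x i).

(* The first summand compares the heights [phi i] and [kap i] on the i-th
   annulus, the second one the radii [x i] and [M i] of the level sets. *)
Let gap (z : 'rV[R]_n) := shells (fun i => phi i - kap i) x (x \o succn) m z
  + shells (fun i => kap i - kap i.+1) (min_M \o succn) (x \o succn) m z.

Context (h : 'rV[R]_n -> R).
Hypotheses (h0 : forall z, 0 <= h z) (mh : lebesgue_measurable h).
Hypothesis hM : forall i z, (i < m)%N -> euclidean_norm z < M i.+1 -> eta i <= h z.

(** [h] dominates the step function with heights [eta] and radii [M], and each of its annuli gains
    the factor [1 + c psi ^+ 2] over [p]. Any excess mass of [h] thus bounds the average of
    [psi ^+ 2]. *)
Lemma coupled_mass :
  ((A + c * (V * \sum_(i < m) p i * psi i ^+ 2))%:E <= integral_Rn h)%E.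
Proof.
apply: (@le_trans _ _ (integral_Rn (annuli eta M m : 'rV[R]_n -> R))); last first.
  apply: le_integral_Rn => //.
  - by move=> z; apply: shells_ge0 => i _; rewrite mulr_ge0 ?powR_ge0.
  - exact: measurable_shells.
  - move=> z; apply: annuli_le => //; first by rewrite /M x0 y0 !mulr0 addr0.
    by move=> i im; exact: hM.
rewrite /annuli integral_shells//; last first.
- by move=> i im; rewrite /= MM// andbT M0// ltnW.
- by move=> i _; rewrite mulr_ge0 ?powR_ge0.
rewrite lee_fin /A mulrCA -mulrDr ler_wpM2l//.
rewrite mulr_sumr -big_split/=; apply: ler_sum => i _.
by have := eta_dN i (ltn_ord i); rewrite -/(p i); lra.
Qed.

Lemma coupled_annuli_le z : annuli phi x m z <= h z + gap z.
Proof.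
have x1' i : (i < m)%N -> x i <= x i.+1 by move=> im; rewrite ltW ?x1.
have Mi0 : M 0%N = 0 by rewrite /M x0 y0 !mulr0 addr0.
have H : annuli kap M m z <= h z.
  apply: annuli_le => // i im zM; apply: le_trans (hM i z im zM).
  by rewrite ge_min lexx orbT.
apply: le_trans (lerD H (lexx _)); rewrite -lerBlDl /gap.
have -> : annuli phi x m z =
    shells (fun i => phi i - kap i) x (x \o succn) m z + annuli kap x m z.
  by rewrite /annuli /shells -big_split/=; apply: eq_bigr => i _; rewrite -mulrDl subrK.
rewrite -addrA lerD2l annuliE// annuliE//.
(* Layer-cake form: since [kap] decreases, the profiles with radii [x] and [M] can be compared ball
   by ball, and two ball indicators differ by at most the indicator of the shell between [min_M] and
   [x]. *)
have E (rho : nat -> R) : rho 0%N = 0 ->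
    \sum_(i < m) kap i * ((euclidean_norm z < rho i.+1)%R%:R - (euclidean_norm z < rho i)%R%:R)
    = \sum_(i < m) (kap i - kap i.+1) * (euclidean_norm z < rho i.+1)%R%:R.
  move=> rho0; have := abel_sum R kap (fun i => (euclidean_norm z < rho i)%R%:R) m.
  by rewrite /= rho0 (ltNge _ 0) sqrtr_ge0 kapm mul0r addr0 => <-.
rewrite !E// -sumrB; apply: ler_sum => i _; rewrite -mulrBr ler_wpM2l ?subr_ge0 ?kap1//=.
rewrite /min_M ge_min; case: ltP => zx; case: ltP => zM //=; rewrite ?subr0 ?subrr ?sub0r ?andbT//.
by rewrite lerN10.
Qed.

Lemma gap_ge0 z : 0 <= gap z.
Proof.
rewrite addr_ge0// shells_ge0// => i im; rewrite subr_ge0 ?kap1//.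
by rewrite ge_min lexx.
Qed.

Lemma measurable_gap : lebesgue_measurable gap.
Proof. by apply: lebesgue_measurableD; exact: measurable_shells. Qed.

Lemma integral_gap :
  (integral_Rn gap <= (2 * (V * \sum_(i < m) p i * psi i))%:E)%E.
Proof.
have min0 i : (i <= m)%N -> 0 <= min_M i <= x i.
  by move=> im; rewrite le_min M0// incr_ge0//= ge_min lexx orbT.
rewrite integral_RnD; first last.
- exact: measurable_shells.
- exact: measurable_shells.
- by move=> z; rewrite shells_ge0// => i im; rewrite subr_ge0 kap1.
- by move=> z; rewrite shells_ge0// => i im; rewrite subr_ge0 ge_min lexx.
rewrite !integral_shells//; first last.
- by move=> i im; rewrite /= (andP (xx i im)).1 ltW ?x1.
- by move=> i im; rewrite subr_ge0 ge_min lexx.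
- by move=> i im; rewrite /= min0.
- by move=> i im; rewrite subr_ge0 kap1.
rewrite -EFinD lee_fin -mulrDr [leRHS]mulrCA ler_wpM2l//.
rewrite mulr2n mulrDl mul1r; apply: lerD.
  apply: ler_sum => i _; rewrite -/(du i) /p mulrAC ler_wpM2r ?du_ge0//.
  by have := kap_ge i (ltn_ord i); rewrite mulrBr mulr1; lra.
(* Displacement of the i-th radius in volume. It grows by at most [du psi] per step: [min_M ^+ n]
   increases by at least [du] if the next minimum is [x i.+1], and by at least the growth of
   [M ^+ n], hence [du (1 - psi)], if it is [M i.+1]. *)
pose e i := x i ^+ n - min_M i ^+ n.
have e0 : e 0%N = 0 by rewrite /e /min_M /M x0 y0 !mulr0 addr0 minxx subrr.
have := abel_sum R kap e m e0; rewrite kapm mul0r addr0 => ->.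
apply: ler_sum => i _; have im := ltn_ord i.
apply: (@le_trans _ _ (kap i * (du i * psi i))).
  rewrite ler_wpM2l ?kap0//.
  have := shell_growth_min n l _ _ _ _ n0 l01 (xx i im) (yy i im).
  rewrite -/(du i) -/(dv i) -/(M i) -/(M i.+1) => H.
  have := disparity_le _ _ (du0 i im) (dv0 i im); rewrite -/(psi i) => /le_trans/(_ H).
  have Mx j : (j <= m)%N -> min_M j ^+ n = Num.min (M j ^+ n) (x j ^+ n).
    by move=> jm; rewrite exprn_min ?M0 ?incr_ge0.
  have dp : 0 <= du i * psi i by rewrite mulr_ge0 ?psi0 ?du_ge0.
  have : min_M i ^+ n <= M i ^+ n by rewrite Mx ?ge_min ?lexx// ltnW.
  have : min_M i ^+ n <= x i ^+ n by rewrite Mx ?ge_min ?lexx ?orbT// ltnW.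
  have : min_M i.+1 ^+ n = M i.+1 ^+ n \/ min_M i.+1 ^+ n = x i.+1 ^+ n.
    by rewrite Mx//; case: (leP (M i.+1 ^+ n) (x i.+1 ^+ n)); [left|right].
  rewrite /e /du; move: dp; set w := _ * psi i; rewrite mulrBr mulr1 -/(du i).
  have -> : du i * psi i = w by [].
  rewrite /du; lra.
by rewrite mulrA ler_wpM2r ?psi0// ler_wpM2r ?du_ge0// ge_min lexx.
Qed.

Lemma coupled_annuli (e : R) : 0 < e -> 0 < A ->
  (integral_Rn h <= ((1 + e) * A)%:E)%E ->
  exists2 D : 'rV[R]_n -> R,
    [/\ forall z, 0 <= D z, lebesgue_measurable D &
      forall z, annuli phi x m z <= h z + D z] &
    (integral_Rn D <= (2 * Num.sqrt (e / c) * A)%:E)%E.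
Proof.
move=> e0 A0 hA; exists gap.
  by split; [exact: gap_ge0|exact: measurable_gap|exact: coupled_annuli_le].
apply: le_trans integral_gap _; rewrite lee_fin -mulrA ler_wpM2l//.
have /andP[l0 l1] := l01.
have c0 : 0 < c by rewrite divr_gt0 ?mulr_gt0 ?exprn_gt0 ?ltr0n// lt_min l0 subr_gt0.
have ec0 : 0 < e / c by rewrite divr_gt0.
(* The average of [psi ^+ 2] will be at most [s ^+ 2], so this [s] balances the two terms of the
   AM-GM below. *)
set s := Num.sqrt (e / c); have s0 : 0 < s by rewrite sqrtr_gt0.
have sE : s ^+ 2 * c = e by rewrite (sqr_sqrtr (ltW ec0)) divfK ?gt_eqF.
have := le_trans coupled_mass hA; rewrite lee_fin.
set S := V * _ => HS.
have HS' : c * S <= e * A by lra.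
have SA : S <= s ^+ 2 * A by rewrite -(ler_pM2l c0); apply: (le_trans HS'); rewrite -sE; lra.
(* AM-GM: [2 psi <= psi^2 / s + s] *)
have : 2 * s * (V * \sum_(i < m) p i * psi i) <= S + s ^+ 2 * A.
  rewrite /S /A mulrCA [s ^+ 2 * _]mulrCA -mulrDr ler_wpM2l//.
  rewrite !mulr_sumr -big_split/=; apply: ler_sum => i _.
  have := p0 i (ltn_ord i); rewrite -/(p i); set q := p i; set w := psi i => q0.
  have : 0 <= q * (w - s) ^+ 2 by rewrite mulr_ge0 ?sqr_ge0 ?(ltW q0).
  by lra.
set T := V * _ => HT.
by rewrite -(ler_pM2l s0); lra.
Qed.

End coupled_annuli.

(** * Transport of step functions *)

Section coupling.
Context {R : realType}.
Implicit Types (U W : R -> R) (cs ds : seq R) (c d u v : R).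

(* The step function taking the value [c] between the volumes [U c'] and [U c],
   where [c'] precedes [c] in [cs] (and [U c'] stands for [u] at the head). *)
Fixpoint levels U u cs : Prop :=
  if cs is c :: cs' then
    [/\ 0 < c, u <= U c, {in cs', forall c', c' <= c} & levels U (U c) cs']
  else True.

Fixpoint mass U u cs : R :=
  if cs is c :: cs' then c * (U c - u) + mass U (U c) cs' else 0.

Lemma levels_ge U u cs : levels U u cs -> {in cs, forall c, u <= U c}.
Proof.
elim: cs u => //= c cs ih u [_ uc _ /ih h] c'; rewrite inE => /predU1P[->//|/h].
exact: le_trans.
Qed.

Lemma mass_ge0 U u cs : levels U u cs -> 0 <= mass U u cs.
Proof.
elim: cs u => //= c cs ih u [c0 uc _ /ih h].
by rewrite addr_ge0// mulr_ge0 ?subr_ge0// ltW.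
Qed.

Lemma mass_eq0 U u cs : levels U u cs -> mass U u cs = 0 ->
  {in cs, forall c, U c <= u}.
Proof.
elim: cs u => //= c cs ih u [c0 uc _ h] m0.
have m1 := mass_ge0 _ _ _ h.
have m2 : 0 <= c * (U c - u) by rewrite mulr_ge0 ?subr_ge0// ltW.
have /eqP : c * (U c - u) = 0 by lra.
rewrite mulf_eq0 gt_eqF//= subr_eq0 => /eqP Uu.
move=> c'; rewrite inE => /predU1P[->|]; first by rewrite Uu.
by rewrite -[X in _ <= X]Uu; apply: ih h _ _; lra.
Qed.

(** The bounds [x i.+1 <= U (phi i)] keep each piece inside a level set, as the lower bound on [h]
    requires. The last clause says that every nontrivial level ends at a breakpoint, so that the
    pieces dominate the step function; it has [c <= phi i] because distinct heights may share the
    same volume. *)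
Definition coupling U u cs W v ds : Prop :=
  exists m : nat, exists phi x gam y : nat -> R,
  [/\ [/\ x 0%N = u, y 0%N = v, phi m = 0 & gam m = 0],
    forall i, (i < m)%N ->
      [/\ 0 < phi i, x i < x i.+1 & x i.+1 <= U (phi i)] /\
      [/\ 0 < gam i, y i < y i.+1 & y i.+1 <= W (gam i)],
    forall i, (i < m)%N -> phi i * (x i.+1 - x i) = gam i * (y i.+1 - y i) /\
      phi i \in cs /\ gam i \in ds,
    forall i j, (i <= j < m)%N -> phi j <= phi i /\ gam j <= gam i &
    {in cs, forall c, U c <= u \/
      exists i, [/\ (i < m)%N, c <= phi i & x i.+1 = U c]} /\
    {in ds, forall d, W d <= v \/
      exists i, [/\ (i < m)%N, d <= gam i & y i.+1 = W d]}].

Lemma coupling_sym U u cs W v ds :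
  coupling U u cs W v ds -> coupling W v ds U u cs.
Proof.
move=> [m [phi [x [gam [y [[xu yv p0 g0] H1 H2 H3 [H4 H5]]]]]]].
exists m, gam, y, phi, x; split => //.
- by move=> i /H1[].
- by move=> i /H2[-> []].
- by move=> i j /H3[].
Qed.

Lemma coupling_drop U u c cs W v ds : U c = u ->
  coupling U u cs W v ds -> coupling U u (c :: cs) W v ds.
Proof.
move=> Uc [m [phi [x [gam [y [[xu yv p0 g0] H1 H2 H3 [H4 H5]]]]]]].
exists m, phi, x, gam, y; split => //.
- by move=> i /H2[-> [pc ->]]; rewrite inE pc orbT.
- split=> // c'; rewrite inE => /predU1P[->|]; first by left; rewrite Uc.
  exact: H4.
Qed.

Let ncons_fun (a : R) (f : nat -> R) (i : nat) := if i is j.+1 then f j else a.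

(** The new first piece exhausts the level [c] but uses [d] only up to [v1]; hence [d] stays at the
    head of the remaining problem. *)
Lemma coupling_cons U u c cs W v d ds (v1 : R) :
  0 < c -> 0 < d -> u < U c -> v < v1 <= W d -> c * (U c - u) = d * (v1 - v) ->
  {in cs, forall c', c' <= c} -> {in ds, forall d', d' <= d} ->
  levels U (U c) cs -> levels W v1 (d :: ds) ->
  coupling U (U c) cs W v1 (d :: ds) -> coupling U u (c :: cs) W v (d :: ds).
Proof.
move=> c0 d0 uU /andP[vv1 v1W] cd cmax dmax lU lW.
move=> [m [phi [x [gam [y [[xu yv p0 g0] H1 H2 H3 [H4 H5]]]]]]].
have cmax' i : (i < m)%N -> phi i <= c by move=> /H2[_ [/cmax]].
have dmax' i : (i < m)%N -> gam i <= d.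
  by move=> /H2[_ [_]]; rewrite inE => /predU1P[->//|/dmax].
exists m.+1, (ncons_fun c phi), (ncons_fun u x), (ncons_fun d gam), (ncons_fun v y).
split => //.
- by move=> [|i] im /=; [rewrite xu yv|exact: H1].
- move=> [|i] im /=; first by rewrite xu yv !mem_head.
  by have [-> [pc gd]] := H2 _ im; rewrite inE pc orbT.
- move=> [|i] [|j] //=; last exact: H3.
  by move=> jm; rewrite cmax' ?dmax'.
(* A level that was trivial for the remaining problem has the same volume as the end of the new
   piece, so index [0] serves for it. *)
- split=> [c'|d'] h; right.
  + move: h; rewrite inE => /predU1P[->|h]; first by exists 0%N; split => //=; rewrite ?xu.
    have [h'|[i [im ci xi]]] := H4 _ h; last by exists i.+1.
    exists 0%N; split => //=; first exact: cmax.
    by rewrite xu; apply/eqP; rewrite eq_le h' (levels_ge _ _ _ lU).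
  + have d'd : d' <= d by move: h; rewrite inE => /predU1P[->//|/dmax].
    have [h'|[i [im ci xi]]] := H5 _ h; last by exists i.+1.
    exists 0%N; split => //=.
    by rewrite yv; apply/eqP; rewrite eq_le h' (levels_ge _ _ _ lW).
Qed.

(* The monotone transport between two step functions of the same mass is
   piecewise linear: the two profiles can be cut into pieces of equal mass. *)
Lemma couplingP U u cs W v ds : levels U u cs -> levels W v ds ->
  mass U u cs = mass W v ds -> coupling U u cs W v ds.
Proof.
have [k] := ubnP (size cs + size ds).
elim: k U u cs W v ds => // k ih U u cs W v ds.
have nil U' u' W' v' ds' : levels W' v' ds' -> 0 = mass W' v' ds' ->
    coupling U' u' [::] W' v' ds'.
  move=> h m0; exists 0%N, (fun=> 0), (fun=> u'), (fun=> 0), (fun=> v').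
  split => //; split=> // d' /(mass_eq0 _ _ _ h (esym m0)) H; left; exact: H.
case: cs => [|c cs]; first by move=> _ _; exact: nil.
case: ds => [|d ds].
  by move=> _ h _ /= e; apply: coupling_sym; apply: nil.
rewrite ltnS => sk lU lW E; have /= [c0 uU cmax lcs] := lU.
have /= [d0 vW dmax lds] := lW; move: (E) => /= E'.
move: uU; rewrite le_eqVlt => /predU1P[uU|uU].
  apply: coupling_drop => //; apply: ih => //; first by rewrite uU.
  by rewrite -E -[mass U u (c :: cs)]/(_ + _) -uU subrr mulr0 add0r.
move: vW; rewrite le_eqVlt => /predU1P[vW|vW].
  apply/coupling_sym/coupling_drop => //; apply/coupling_sym/ih => //.
  - by rewrite addnS in sk.
  - by rewrite vW.
  - by rewrite E -[mass W v (d :: ds)]/(_ + _) -vW subrr mulr0 add0r.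
(* Greedy cut: of the two top levels, the one of smaller remaining mass is used up and the other is
   shortened, so the total number of levels drops. *)
have [pq|/ltW pq] := leP (c * (U c - u)) (d * (W d - v)).
  pose v1 := v + c * (U c - u) / d.
  have v1E : d * (v1 - v) = c * (U c - u).
    by rewrite /v1 addrC addKr mulrC divfK// gt_eqF.
  have v1W : v1 <= W d by rewrite -(lerD2r (- v)) -(ler_pM2l d0) v1E.
  have vv1 : v < v1 by rewrite -subr_gt0 -(pmulr_rgt0 _ d0) v1E mulr_gt0 ?subr_gt0.
  apply: (@coupling_cons _ _ _ _ _ _ _ _ v1) => //; first by rewrite vv1.
  by apply: ih => //=; lra.
pose u1 := u + d * (W d - v) / c.
have u1E : c * (u1 - u) = d * (W d - v).
  by rewrite /u1 addrC addKr mulrC divfK// gt_eqF.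
have u1U : u1 <= U c by rewrite -(lerD2r (- u)) -(ler_pM2l c0) u1E.
have uu1 : u < u1 by rewrite -subr_gt0 -(pmulr_rgt0 _ c0) u1E mulr_gt0 ?subr_gt0.
apply: coupling_sym; apply: (@coupling_cons _ _ _ _ _ _ _ _ u1) => //; first by rewrite uu1.
apply: coupling_sym; apply: ih => //=; first by rewrite addnS in sk.
by lra.
Qed.

End coupling.

(** * Level sets *)

Section simple_approximation.
Context {R : realType} {n : nat}.
Import HBNNSimple.

(** The approximant [s] is not assumed radial: a point with [s z = c] lies in the level set of [f]
    at [c], so only the values of [s] and the level radii of [f] enter later. *)
Lemma simple_approx (f : 'rV[R]_n -> R) (I e : R) :
  (forall x, 0 <= f x) -> integral_Rn f = I%:E -> 0 < e ->
  exists (s : 'rV[R]_n -> R) (cs : seq R),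
    [/\ lebesgue_measurable s, forall x, 0 <= s x <= f x,
      ((I - e)%:E <= integral_Rn s)%E, sorted >=%R cs &
      (forall x, s x = 0 \/ s x \in cs) /\
      (forall c, c \in cs -> 0 < c /\ exists x, c <= f x)].
Proof.
move=> f0 fI e0; move: fI; rewrite /integral_Rn ge0_integralTE; last first.
  by move=> x; rewrite lee_fin.
set S := [set _ | _ in _] => SI.
have Sfin : ereal_sup S \is a fin_num by rewrite SI.
have [_ [s /= sf <-]] := ub_ereal_sup_adherent e0 Sfin.
rewrite SI => Is.
have /finite_seqP[r rE] : finite_set (range s) by exact: fimfunP.
have sf' x : s x <= f x by rewrite -lee_fin; exact: sf.
exists s, (sort >=%R [seq c <- r | 0 < c]); split.
- exact: (@measurable_funPT _ _ _ _ s).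
- by move=> x; rewrite sf' andbT; exact: fun_ge0.
- by rewrite [X in (_ <= X)%E](integralT_nnsfun (lebesgue_Rn R n) s); exact: ltW.
- by apply: sort_sorted => a b; exact: le_total.
- split=> [x|c].
    have : 0 <= s x by exact: fun_ge0.
    rewrite le_eqVlt => /predU1P[<-|sx]; [by left|right].
    rewrite mem_sort mem_filter sx /=.
    by have : range s (s x) by []; rewrite rE.
  rewrite mem_sort mem_filter => /andP[c0 cr]; split => //.
  have : range s c by rewrite rE.
  by move=> [x _ <-]; exists x; exact: sf'.
Qed.

Lemma negligible_spheres (rs : seq R) : (0 < n)%N ->
  let N := [set x : 'rV[R]_n | euclidean_norm x \in rs] in
  measurable (N : set (Rn R n)) /\ lebesgue_Rn R n N = 0%E.
Proof.
move=> n0; elim: rs => [|r rs [mN N0]].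
  rewrite (_ : [set _ | _] = set0); first by split; [exact: measurable0|exact: measure0].
  by apply/seteqP; split => x.
set S := [set x : 'rV[R]_n | euclidean_norm x = r].
have mS : measurable (S : set (Rn R n)).
  rewrite (_ : S = (@euclidean_norm R n) @^-1` [set r])//.
  by rewrite -[X in measurable X]setTI; exact: measurable_euclidean_norm.
rewrite /= (_ : [set _ | _] = S `|` [set x : 'rV[R]_n | euclidean_norm x \in rs]); last first.
  apply/seteqP; split => x /=; rewrite inE.
    by move=> /predU1P[xr|xr]; [left|right].
  by move=> [->|->]; rewrite ?eqxx ?orbT.
split; first exact: measurableU.
apply/eqP; rewrite eq_le; apply/andP; split; last exact: (measure_ge0 (lebesgue_Rn R n)).
apply: le_trans (outer_measureU2 (lebesgue_outer R n) _ _) _.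
rewrite -[0%E]adde0; apply: leeD; first by rewrite -(lebesgue_sphere r n0).
by rewrite -N0.
Qed.

End simple_approximation.

Section radius.
Context {R : realType} {n : nat}.
Implicit Types f : 'rV[R]_n -> R.

Definition level_norms f (c : R) : set R :=
  [set euclidean_norm y | y in [set y : 'rV[R]_n | c <= f y]].

Definition level_radius f c : R := sup (level_norms f c).

(* For radial functions the largest norm of [l *: x + (1 - l) *: y] is attained
   by parallel [x] and [y]; log-concavity then covers the smaller norms. *)
Definition radial_sup (l : R) f g h := forall x y z : 'rV[R]_n,
  euclidean_norm z <= l * euclidean_norm x + (1 - l) * euclidean_norm y ->
  f x `^ l * g y `^ (1 - l) <= h z.

Section level_sets.
Context (l : R) (f g h : 'rV[R]_n -> R).
Hypotheses (n0 : (0 < n)%N) (l01 : 0 < l < 1).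
Hypotheses (f0 : forall x, 0 <= f x) (g0 : forall x, 0 <= g x) (h0 : forall x, 0 <= h x).
Hypothesis mh : lebesgue_measurable h.
Hypotheses (gI : (0 < integral_Rn g)%E) (hI : (integral_Rn h < +oo)%E).
Hypothesis fgh : radial_sup l f g h.

(** If [f x >= c], then [h >= k] on the ball of radius [r = l |x|], so [k V r ^+ n] is at most the
    integral of [h]. The summand [1] in the bound covers [r <= 1], where [r <= r ^+ n] can fail. *)
Lemma level_norms_bounded c : 0 < c -> has_ubound (level_norms f c).
Proof.
move=> c0; have /andP[l0 l1] := l01.
have [y0 gy0] : exists y0, 0 < g y0.
  apply: contrapT => H; move: gI; rewrite (@eq_integral_Rn _ _ _ (cst 0)).
    by rewrite /integral_Rn integral0 ltxx.
  move=> x; apply/eqP; rewrite eq_le g0 andbT leNgt; apply/negP => gx.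
  by apply: H; exists x.
pose k := c `^ l * g y0 `^ (1 - l).
have k0 : 0 < k by rewrite mulr_gt0 ?powR_gt0.
have V0 := @unit_ball_volume_gt0 R n; set V := unit_ball_volume in V0.
pose H := fine (integral_Rn h).
have HE : integral_Rn h = H%:E.
  by rewrite /H fineK// ge0_fin_numE// integral_Rn_ge0.
have H0 : 0 <= H by rewrite -lee_fin -HE integral_Rn_ge0.
exists ((1 + H / (k * V)) / l) => _ [x /= cx <-].
rewrite ler_pdivlMr// mulrC; set r := l * _.
have r0 : 0 <= r by rewrite mulr_ge0 ?sqrtr_ge0// ltW.
have [r1|/ltW r1] := leP r 1.
  by rewrite (le_trans r1)// lerDl divr_ge0// mulr_ge0// ltW.
have rn : r <= r ^+ n.
  by case: (n) n0 => // n' _; rewrite exprS ler_peMr// exprn_ege1.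
apply: (le_trans rn); apply: (@le_trans _ _ (H / (k * V))); last by rewrite lerDr.
rewrite ler_pdivlMr; last exact: mulr_gt0.
suff : ((r ^+ n * (k * V))%:E <= integral_Rn h)%E by rewrite HE lee_fin.
have -> : (r ^+ n * (k * V))%:E =
    integral_Rn (shells (fun=> k) (fun=> 0) (fun=> r) 1 : 'rV[R]_n -> R).
  rewrite integral_shells//; first last.
  - by move=> i _; rewrite lexx.
  - by move=> i _; exact: ltW.
  by rewrite big_ord1 expr0n gtn_eqF// subr0 -/V; congr EFin; ring.
apply: le_integral_Rn => //.
- by move=> z; rewrite shells_ge0// => i _; exact: ltW.
- exact: measurable_shells.
- move=> z; rewrite /shells big_ord1.
  have [/andP[_ zr]|_] := boolP (_ <= _ < _); last by rewrite mulr0.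
  rewrite mulr1 /k.
  apply: le_trans (fgh x y0 z _); last first.
    by rewrite (le_trans (ltW zr))// lerDl mulr_ge0 ?sqrtr_ge0// subr_ge0 ltW.
  by rewrite ler_wpM2r ?powR_ge0// ge0_ler_powR ?nnegrE ?f0 ?(ltW l0) ?(ltW c0).
Qed.

Lemma level_radius_ge c x : 0 < c -> c <= f x -> euclidean_norm x <= level_radius f c.
Proof.
move=> c0 cx; apply: ub_le_sup; first exact: level_norms_bounded.
by exists x.
Qed.

Lemma level_radius_antitone c c' : 0 < c -> (exists x, c' <= f x) -> c <= c' ->
  0 <= level_radius f c' <= level_radius f c.
Proof.
move=> c0 [x cx] cc; apply/andP; split.
  by apply: le_trans (level_radius_ge _ x (lt_le_trans c0 cc) cx); exact: sqrtr_ge0.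
apply: ge_sup; first by exists (euclidean_norm x), x.
move=> _ [y /= cy <-]; apply: level_radius_ge => //; exact: le_trans cy.
Qed.

End level_sets.

Lemma radial_supC l f g h : radial_sup l f g h -> radial_sup (1 - l) g f h.
Proof. by move=> H x y z; rewrite subKr addrC => yx; rewrite mulrC; exact: H. Qed.

(** The suprema need not be attained. The strict inequality leaves a slack [e = l e + (1 - l) e],
    enough for points [x], [y] whose norms are within [e] of the two radii. *)
Lemma level_radius_sup l f g h c d z : 0 < l < 1 -> radial_sup l f g h -> 0 < c -> 0 < d ->
  has_ubound (level_norms f c) -> has_ubound (level_norms g d) ->
  (exists x, c <= f x) -> (exists y, d <= g y) ->
  euclidean_norm z < l * level_radius f c + (1 - l) * level_radius g d ->
  c `^ l * d `^ (1 - l) <= h z.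
Proof.
move=> /andP[l0 l1] fgh c0 d0 uf ug [x0 cx0] [y0 dy0] zr.
have l1' : 0 <= 1 - l by rewrite subr_ge0 ltW.
pose e := l * level_radius f c + (1 - l) * level_radius g d - euclidean_norm z.
have e0 : 0 < e by rewrite subr_gt0.
have [_ [x /= cx <-] xr] : exists2 r, level_norms f c r & level_radius f c - e < r.
  by apply: sup_adherent => //; split => //; exists (euclidean_norm x0), x0.
have [_ [y /= dy <-] yr] : exists2 r, level_norms g d r & level_radius g d - e < r.
  by apply: sup_adherent => //; split => //; exists (euclidean_norm y0), y0.
apply: (@le_trans _ _ (f x `^ l * g y `^ (1 - l))).
  have fx : 0 <= f x by rewrite (le_trans (ltW c0)).
  have gy : 0 <= g y by rewrite (le_trans (ltW d0)).
  by rewrite ler_pM ?powR_ge0// ge0_ler_powR ?nnegrE// ltW.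
by apply: fgh; rewrite /e in xr yr; nra.
Qed.

End radius.

Section levels_theory.
Context {R : realType}.
Implicit Types (U W : R -> R) (cs ds : seq R).

Lemma levels_sorted U u cs : sorted >=%R cs ->
  (forall c, c \in cs -> 0 < c /\ u <= U c) ->
  (forall c c', c \in cs -> c' \in cs -> c' <= c -> U c <= U c') -> levels U u cs.
Proof.
elim: cs u => //= c cs ih u; rewrite (path_sortedE (rev_trans le_trans)).
move=> /andP[/allP cmax scs] H1 H2.
have [c0 uc] := H1 c (mem_head _ _); split => //.
apply: ih => // [c' c'cs|c1 c2 h1 h2]; last first.
  by apply: H2; rewrite inE ?h1 ?h2 orbT.
have c'cs' : c' \in c :: cs by rewrite inE c'cs orbT.
split; first by case: (H1 _ c'cs').
by apply: H2 => //; [exact: mem_head|exact: cmax].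
Qed.

(** Multiplying [g] by [k] multiplies the heights by [k], and the level set at [d] becomes the old
    one at [d / k]. *)
Lemma mass_scale (k : R) W v ds : 0 < k ->
  mass (fun d => W (d / k)) v [seq k * d | d <- ds] = k * mass W v ds.
Proof.
move=> k0; elim: ds v => [|d ds ih] v /=; first by rewrite mulr0.
by rewrite ih [k * d / k]mulrC mulKf ?gt_eqF// [RHS]mulrDr mulrA.
Qed.

Lemma levels_scale (k : R) W v ds : 0 < k -> levels W v ds ->
  levels (fun d => W (d / k)) v [seq k * d | d <- ds].
Proof.
move=> k0; elim: ds v => //= d ds ih v [d0 vd dmax /ih h].
rewrite [k * d / k]mulrC mulKf ?gt_eqF//; split => //; first exact: mulr_gt0.
by move=> _ /mapP[d' /dmax d'd ->]; rewrite ler_pM2l.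
Qed.

End levels_theory.

(** * From a one-sided almost everywhere bound to the L1 distance *)

Section excess.
Context {R : realType} {n : nat} (tau e A F K : R) (f s h D : 'rV[R]_n -> R).
Context (N : set 'rV[R]_n).
Hypotheses (f0 : forall z, 0 <= f z) (s0 : forall z, 0 <= s z <= f z).
Hypotheses (h0 : forall z, 0 <= h z) (D0 : forall z, 0 <= D z).
Hypotheses (mf : lebesgue_measurable f) (ms : lebesgue_measurable s).
Hypotheses (mh : lebesgue_measurable h) (mD : lebesgue_measurable D).
Hypotheses (mN : measurable (N : set (Rn R n))) (N0 : lebesgue_Rn R n N = 0%E).
Hypothesis shD : forall z, ~ N z -> s z <= h z + D z.
Hypotheses (e0 : 0 < e) (tau0 : 0 < tau <= 1) (A0 : 0 < A) (F0 : 0 < F).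
Hypothesis fF : integral_Rn f = F%:E.
Hypothesis sF : ((F / (1 + e))%:E <= integral_Rn s)%E.
Hypotheses (hK : integral_Rn h = K%:E) (KA : K <= (1 + 3 * e) * A).
Hypothesis DA : (integral_Rn D
  <= (2 * Num.sqrt (3 * e / (tau / (4 * n%:R ^+ 2))) * A)%:E)%E.
Hypothesis AF : tau * (A - F) <= 3 * e * A.
Hypothesis etau : e / tau <= 1 / 6.

(** From [s <= f] and [s <= h + D] follows [|f - h| + 2 s <= f + h + 2 D], whichever of [f], [h] is
    larger. Integrated, only the masses remain to be compared. *)
Lemma excess_bound : (integral_Rn (fun z => `|f z - h z|%R)
  <= ((14 + 32 * n%:R) * Num.sqrt (e / tau) * F)%:E)%E.
Proof.
have s0' z : 0 <= s z by case/andP: (s0 z).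
have := DA; set d := 2 * _ * A => Dd.
have [S SE] : exists S, integral_Rn s = S%:E.
  exists (fine (integral_Rn s)); rewrite fineK// ge0_fin_numE ?integral_Rn_ge0//.
  apply: (@le_lt_trans _ _ (integral_Rn f)); last by rewrite fF ltry.
  by apply: le_integral_Rn => // z; case/andP: (s0 z).
have X : (integral_Rn (fun z => `|f z - h z| + 2 * s z)%R
    <= integral_Rn (fun z => f z + h z + 2 * D z)%R)%E.
  apply: (@ae_le_integral_Rn _ _ _ _ N) => //.
  - by move=> z; rewrite addr_ge0// mulr_ge0.
  - by move=> z; rewrite !addr_ge0// mulr_ge0.
  - apply: lebesgue_measurableD; first exact: lebesgue_measurable_dist.
    exact: lebesgue_measurableZ.
  - apply: lebesgue_measurableD; first exact: lebesgue_measurableD.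
    exact: lebesgue_measurableZ.
  - move=> z /shD; have /andP[_] := s0 z; have := D0 z.
    have [/ger0_norm ->|/ltr0_norm ->] := leP 0 (f z - h z); lra.
have mfh := lebesgue_measurable_dist _ _ mf mh.
have mfh' := lebesgue_measurableD _ _ mf mh.
have ms2 := lebesgue_measurableZ 2 _ ms; have mD2 := lebesgue_measurableZ 2 _ mD.
have s2 z : 0 <= 2 * s z by rewrite mulr_ge0.
have D2 z : 0 <= 2 * D z by rewrite mulr_ge0.
have fh0 z : 0 <= f z + h z by rewrite addr_ge0.
have fh1 z : 0 <= `|f z - h z| by exact: normr_ge0.
move: X; rewrite (integral_RnD _ _ fh1 s2 mfh ms2) (integral_RnD _ _ fh0 D2 mfh' mD2).
rewrite (integral_RnD _ _ f0 h0 mf mh) (integral_RnZ _ _ _ s0' ms)// (integral_RnZ _ _ _ D0 mD)//.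
rewrite fF hK SE => X.
move: sF; rewrite SE lee_fin => SF.
have {}X : (integral_Rn (fun z => `|f z - h z|%R) <= (F + K + 2 * d - 2 * S)%:E)%E.
  rewrite EFinB leeBrDr//; apply: le_trans X _.
  rewrite 2!EFinD (EFinM 2 d); apply: leeD2l.
  by apply: lee_wpmul2l Dd; rewrite lee_fin.
apply: le_trans X _; rewrite lee_fin.
case/andP: tau0 => t0 t1.
have := etau; set r := e / tau => r6; have r0 : 0 < r by rewrite divr_gt0.
set q := Num.sqrt r; have q0 : 0 < q by rewrite sqrtr_gt0.
have qE : q ^+ 2 = r by rewrite sqr_sqrtr// ltW.
have rq : r <= q by rewrite -qE; nra.
have eE : e = r * tau by rewrite divfK// gt_eqF.
have er : e <= r by rewrite eE; nra.
have dE : d <= 8 * n%:R * q * A.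
  rewrite /d ler_pM2r// -mulrA -[X in X * n%:R](_ : 2 * 4 = 8); last by ring.
  rewrite -!mulrA ler_pM2l// mulrA.
  rewrite -[leRHS]ger0_norm; last by rewrite !mulr_ge0// ltW.
  rewrite -sqrtr_sqr ler_wsqrtr// 2!exprMn qE eE.
  have n2 : 0 <= n%:R ^+ 2 :> R by rewrite sqr_ge0.
  have -> : 3 * (r * tau) / (tau / (4 * n%:R ^+ 2)) = 12 * n%:R ^+ 2 * r.
    by rewrite invf_div; field; rewrite gt_eqF.
  have : 0 <= n%:R ^+ 2 * r by rewrite mulr_ge0// ltW.
  by set w := n%:R ^+ 2; lra.
have AF' : A - F <= 3 * r * A.
  by rewrite -(ler_pM2l t0); move: AF; rewrite eE; lra.
(* The threshold [1/6] gives [A - F <= 3 r A <= A / 2], hence [A <= 2 F]. *)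
have rA : r * A <= 1 / 6 * A by rewrite ler_wpM2r// ltW.
have A2 : A <= 2 * F by lra.
have S1 : F * (1 - e) <= S.
  apply: le_trans SF; rewrite ler_wpM2l ?(ltW F0)//.
  by rewrite -[leRHS]mul1r ler_pdivlMr; nra.
have n0 : 0 <= n%:R :> R by [].
have nq : 0 <= n%:R * q by rewrite mulr_ge0// ltW.
have h1 : n%:R * q * A <= n%:R * q * (2 * F) by rewrite ler_wpM2l.
have h2 : e * A <= r * (2 * F) by rewrite ler_pM// ltW.
have h3 : e * F <= r * F by rewrite ler_wpM2r// ltW.
have h4 : r * F <= q * F by rewrite ler_wpM2r// ltW.
have h5 : r * A <= r * (2 * F) by rewrite ler_wpM2l// ltW.
move: dE h1 KA; set w : R := n%:R => dE h1 K'A.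
(* With [A <= 2 F] and [e <= r <= q], the first three terms contribute [6 + 6 + 2 = 14] times [q F],
   the last one [32 n] times [q F]. *)
have : F + K + 2 * d - 2 * S <= (A - F) + 3 * (e * A) + 2 * (e * F) + 16 * (w * q * A) by lra.
lra.
Qed.

End excess.

(** * Stability for radial suprema *)

(** Translates the last clause of [coupling], started at volume [0], into a pointwise bound;
    [|z| < r] rules out a trivial level. *)
Lemma le_annuli_root (R : realType) (n m : nat) (phi u : nat -> R) (v r : R) (z : 'rV[R]_n) :
  (0 < n)%N -> u 0%N = 0 -> (forall i, (i < m)%N -> u i < u i.+1) ->
  (forall i, (i < m)%N -> 0 < phi i) ->
  (forall i j, (i <= j < m)%N -> phi j <= phi i) ->
  0 <= r -> v = 0 \/ euclidean_norm z < r /\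
    (r ^+ n <= 0 \/ exists i, [/\ (i < m)%N, v <= phi i & u i.+1 = r ^+ n]) ->
  v <= annuli phi (nth_root n \o u) m z.
Proof.
move=> n0 u0 u1 phi0 phi1 r0.
have phi0' i : (i < m)%N -> 0 <= phi i by move=> im; rewrite ltW ?phi0.
case=> [->|[zr [rn|[i [im vi ui]]]]]; first exact: shells_ge0.
  have : 0 < r ^+ n by rewrite exprn_gt0// (le_lt_trans _ zr)// sqrtr_ge0.
  by rewrite ltNge rn.
apply: (le_trans vi); apply: annuli_ge => //=.
- by rewrite u0 nth_root0.
- move=> j jm; rewrite ltW// nth_root_lt ?u1//.
  by apply: (incr_ge0 m u j u0 u1); exact: ltnW.
- by rewrite ui exprn_nth_root.
Qed.

Section radial_sup_stability.
Context {R : realType} {n : nat} (n0 : (0 < n)%N).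
Implicit Types (l e : R) (f g h : 'rV[R]_n -> R).

Lemma radial_profile l f g h (I e : R) : 0 < l < 1 ->
  (forall x, 0 <= f x) -> (forall x, 0 <= g x) -> (forall x, 0 <= h x) ->
  lebesgue_measurable h -> (0 < integral_Rn g)%E -> (integral_Rn h < +oo)%E ->
  radial_sup l f g h -> integral_Rn f = I%:E -> 0 < e < I ->
  let U c := level_radius f c ^+ n in
  exists (s : 'rV[R]_n -> R) (cs : seq R) (N : set 'rV[R]_n),
  [/\ lebesgue_measurable s, forall x, 0 <= s x <= f x,
      ((I - e)%:E <= integral_Rn s)%E, levels U 0 cs & 0 < mass U 0 cs] /\
  [/\ measurable (N : set (Rn R n)), lebesgue_Rn R n N = 0%E,
      (forall z, ~ N z -> s z = 0 \/ s z \in cs /\ euclidean_norm z < level_radius f (s z)) &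
      forall c, c \in cs -> [/\ 0 < c, exists x, c <= f x, 0 <= level_radius f c &
        has_ubound (level_norms f c)]].
Proof.
move=> l01 f0 g0 h0 mh gI hI fgh fI /andP[e0 eI] U.
have [s [cs [ms sf Is scs [scsP csP]]]] := simple_approx f I e f0 fI e0.
have [mN N0] := negligible_spheres [seq level_radius f c | c <- cs] n0.
(* A supremum only gives [|z| <= level_radius f (s z)]; off these spheres the inequality is strict,
   as half-open annuli demand. *)
set N := [set x | _] in mN N0.
have csP' c : c \in cs -> [/\ 0 < c, exists x, c <= f x, 0 <= level_radius f c &
    has_ubound (level_norms f c)].
  move=> /csP[c0 cx]; split => //; last exact: (@level_norms_bounded _ _ l f g h).
  by have /andP[] := level_radius_antitone l f g h n0 l01 f0 g0 h0 mh gI hI fgh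
    c c c0 cx (lexx c).
have sN z : ~ N z -> s z = 0 \/ s z \in cs /\ euclidean_norm z < level_radius f (s z).
  move=> Nz; have [->|szcs] := scsP z; [by left|right; split => //].
  rewrite lt_neqAle; apply/andP; split; last first.
    apply: (@level_radius_ge _ _ l f g h) => //; first by have [] := csP' _ szcs.
    by case/andP: (sf z).
  by apply/eqP => zr; apply: Nz; rewrite /N /= zr map_f.
have lU : levels U 0 cs.
  apply: levels_sorted => // [c /csP'[c0 _ r0 _]|c c' /csP'[c0 cx r0 _] /csP'[c'0 c'x r'0 _] c'c].
    by split => //; exact: exprn_ge0.
  rewrite /U lerXn2r// ?nnegrE//.
  by have /andP[] := level_radius_antitone l f g h n0 l01 f0 g0 h0 mh gI hI fgh
    c' c c'0 cx c'c.
exists s, cs, N; split; split => //.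
(* Zero mass would make all level radii vanish, hence [s = 0] almost everywhere, contradicting
   [e < I]. *)
rewrite lt_neqAle mass_ge0// andbT eq_sym; apply/eqP => m0.
have U0 := mass_eq0 _ _ _ lU m0.
suff : (integral_Rn s <= 0)%E.
  by rewrite leNgt => /negP; apply; rewrite (lt_le_trans _ Is)// lte_fin subr_gt0.
rewrite [leRHS](_ : _ = integral_Rn (cst 0 : 'rV[R]_n -> R)); last first.
  by rewrite /integral_Rn integral0.
apply: (@ae_le_integral_Rn _ _ _ _ N) => //.
- by move=> x; case/andP: (sf x).
- exact: measurable_cst.
- move=> z /sN[->//|[szcs zr]]; exfalso.
  have := U0 _ szcs; rewrite leNgt exprn_gt0//.
  by rewrite (le_lt_trans _ zr)// sqrtr_ge0.
Qed.

Lemma radial_sup_stability l e f g h (F G : R) : 0 < l < 1 -> 0 < e ->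
  let tau := Num.min l (1 - l) in
  e / tau <= 1 / 6 ->
  (forall x, 0 <= f x) -> (forall x, 0 <= g x) -> (forall x, 0 <= h x) ->
  lebesgue_measurable f -> lebesgue_measurable g -> lebesgue_measurable h ->
  0 < F -> 0 < G -> integral_Rn f = F%:E -> integral_Rn g = G%:E ->
  radial_sup l f g h ->
  (integral_Rn h <= ((1 + e) * (F `^ l * G `^ (1 - l)))%:E)%E ->
  let C := (14 + 32 * n%:R) * Num.sqrt (e / tau) in
  exists2 a : R, 0 < a &
    (integral_Rn (fun x => `|f x - a `^ (1 - l) * h x|%R) <= (C * F)%:E)%E /\
    (integral_Rn (fun x => `|g x - a `^ (- l) * h x|%R) <= (C * G)%:E)%E.
Proof.
move=> l01 e0 tau etau f0 g0 h0 mf mg mh F0 G0 fF gG fgh hFG C.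
have /andP[l0 l1] := l01; have l1' : 0 < 1 - l by rewrite subr_gt0.
have l01' : 0 < 1 - l < 1 by rewrite l1' ltrBlDr ltrDl.
have tau0 : 0 < tau <= 1 by rewrite lt_min l0 l1' ge_min ltW.
have e1 : e <= 1 / 6.
  apply: le_trans etau; rewrite ler_pdivlMr; last by case/andP: tau0.
  by rewrite ler_piMr//; [exact: ltW|case/andP: tau0].
have hfin : (integral_Rn h < +oo)%E by apply: le_lt_trans hFG _; rewrite ltry.
pose K := fine (integral_Rn h).
have hK : integral_Rn h = K%:E by rewrite fineK// ge0_fin_numE// integral_Rn_ge0.
have KFG : K <= (1 + e) * (F `^ l * G `^ (1 - l)) by rewrite -lee_fin -hK.
have fI : (0 < integral_Rn f)%E by rewrite fF lte_fin.
have gI : (0 < integral_Rn g)%E by rewrite gG lte_fin.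
have ee I : I - I * (e / (1 + e)) = I / (1 + e) by field; lra.
have eI I : 0 < I -> 0 < I * (e / (1 + e)) < I.
  move=> I0; rewrite mulr_gt0 ?divr_gt0 ?addr_gt0//=.
  by rewrite gtr_pMr// ltr_pdivrMr ?mul1r ?ltrDr// addr_gt0.
have [s [cs [Nf [[ms sf Is lU mU] [mNf Nf0 sN csP]]]]] :=
  radial_profile l f g h F _ l01 f0 g0 h0 mh gI hfin fgh fF (eI _ F0).
have [t [ds [Ng [[mt tg It lW mW] [mNg Ng0 tN dsP]]]]] :=
  radial_profile (1 - l) g f h G _ l01' g0 f0 h0 mh fI hfin
    (radial_supC _ _ _ _ fgh) gG (eI _ G0).
rewrite ee in Is; rewrite ee in It.
set U := fun c => _ in lU mU; set W := fun c => _ in lW mW.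
(* This scaling gives the profiles of [f] and [a g] the same mass. Since [h] is multiplied by
   [a ^ (1 - l)], near-equality is preserved. *)
pose a := mass U 0 cs / mass W 0 ds; have a0 : 0 < a by rewrite divr_gt0.
have lW' := levels_scale a W 0 ds a0 lW.
have Emass : mass U 0 cs = mass (fun d => W (d / a)) 0 [seq a * d | d <- ds].
  by rewrite mass_scale// /a divfK ?gt_eqF.
have [m [phi [u [gam [v [[u0 v0 phim gamm] H1 H2 H3 [H4 H5]]]]]]] :=
  couplingP _ _ _ _ _ _ lU lW' Emass.
have u1 i : (i < m)%N -> u i < u i.+1 by move=> /H1[[]].
have v1 i : (i < m)%N -> v i < v i.+1 by move=> /H1[_ []].
have phi0 i : (i < m)%N -> 0 < phi i by move=> /H1[[]].
have gam0 i : (i < m)%N -> 0 < gam i by move=> /H1[_ []].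
have phi1 i j : (i <= j < m)%N -> phi j <= phi i by move=> /H3[].
have gam1 i j : (i <= j < m)%N -> gam j <= gam i by move=> /H3[].
have u_ge0 i : (i <= m)%N -> 0 <= u i by exact: incr_ge0 u0 u1.
have v_ge0 i : (i <= m)%N -> 0 <= v i by exact: incr_ge0 v0 v1.
pose x := nth_root n \o u; pose y := nth_root n \o v.
have xE i : (i <= m)%N -> x i ^+ n = u i by move=> im; rewrite nth_rootK ?u_ge0.
have yE i : (i <= m)%N -> y i ^+ n = v i by move=> im; rewrite nth_rootK ?v_ge0.
have x0 : x 0%N = 0 by rewrite /x /= u0 nth_root0.
have y0 : y 0%N = 0 by rewrite /y /= v0 nth_root0.
have x1 i : (i < m)%N -> x i < x i.+1.
  by move=> im; apply: nth_root_lt => //; [rewrite u_ge0// ltnW|exact: u1].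
have y1 i : (i < m)%N -> y i < y i.+1.
  by move=> im; apply: nth_root_lt => //; [rewrite v_ge0// ltnW|exact: v1].
have phigam i : (i < m)%N ->
    phi i * (x i.+1 ^+ n - x i ^+ n) = gam i * (y i.+1 ^+ n - y i ^+ n).
  by move=> im; rewrite !xE ?yE// 1?ltnW//; case: (H2 _ im).
pose h' z := a `^ (1 - l) * h z.
have al0 : 0 < a `^ (1 - l) by rewrite powR_gt0.
have h'0 z : 0 <= h' z by rewrite mulr_ge0 ?powR_ge0.
have mh' : lebesgue_measurable h' by exact: lebesgue_measurableZ.
have h'K : integral_Rn h' = (a `^ (1 - l) * K)%:E.
  by rewrite integral_RnZ ?powR_ge0// hK.
have hM i z : (i < m)%N -> euclidean_norm z < l * x i.+1 + (1 - l) * y i.+1 ->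
    phi i `^ l * gam i `^ (1 - l) <= h' z.
  move=> im zM; have [_ [pc]] := H2 _ im => /mapP[d dd gd].
  have [c0 cx rc cb] := csP _ pc; have [d0 dx rd db] := dsP _ dd.
  rewrite gd powRM ?(ltW a0) ?(ltW d0)// mulrCA /h' ler_pM2l//.
  apply: (level_radius_sup l f g h) => //.
  apply: lt_le_trans zM _; apply: lerD; rewrite ler_pM2l//.
    apply: nth_root_le => //; first exact: u_ge0.
    by case: (H1 _ im) => -[].
  apply: nth_root_le => //; first exact: v_ge0.
  by case: (H1 _ im) => _ [_ _]; rewrite gd /W [a * d / a]mulrC mulKf ?gt_eqF.
pose A := unit_ball_volume (n := n) * \sum_(i < m) phi i * (x i.+1 ^+ n - x i ^+ n).
have AE : A = unit_ball_volume (n := n) * \sum_(i < m) gam i * (y i.+1 ^+ n - y i ^+ n).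
  by congr (_ * _); apply: eq_bigr => i _; exact: phigam.
have sx z : ~ Nf z -> s z <= annuli phi x m z.
  move=> /sN sz; have [->|sz0] := eqVneq (s z) 0.
    by apply: shells_ge0 => i im; rewrite ltW ?phi0.
  case: sz => [/eqP|[szcs zr]]; first by rewrite (negbTE sz0).
  have [_ _ r0 _] := csP _ szcs.
  apply: (@le_annuli_root _ _ _ _ _ _ (level_radius f (s z))) => //.
  by right; split => //; exact: H4.
have ty z : ~ Ng z -> a * t z <= annuli gam y m z.
  move=> /tN tz; have [->|tz0] := eqVneq (t z) 0.
    by rewrite mulr0; apply: shells_ge0 => i im; rewrite ltW ?gam0.
  case: tz => [/eqP|[tzds zr]]; first by rewrite (negbTE tz0).
  have [_ _ r0 _] := dsP _ tzds.
  apply: (@le_annuli_root _ _ _ _ _ _ (level_radius g (t z))) => //; right; split => //.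
  have := H5 (a * t z) (map_f _ tzds).
  by rewrite /W [a * t z / a]mulrC mulKf ?gt_eqF.
have s0 z : 0 <= s z by case/andP: (sf z).
have t0 z : 0 <= t z by case/andP: (tg z).
have AF : F / (1 + e) <= A.
  rewrite -lee_fin; apply: (le_trans Is).
  have := @integral_shells R n phi x (x \o succn) m n0.
  rewrite -/A => <-; first last.
  - by move=> i im; rewrite /= nth_root_ge0 ltW ?x1.
  - by move=> i im; rewrite ltW ?phi0.
  apply: (@ae_le_integral_Rn _ _ _ _ Nf) => //; last exact: measurable_shells.
  by move=> z; apply: shells_ge0 => i im; rewrite ltW ?phi0.
have at0 z : 0 <= a * t z by rewrite mulr_ge0 ?(ltW a0).
have mat : lebesgue_measurable (fun z => a * t z) by exact: lebesgue_measurableZ.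
have ItE : ((a * G / (1 + e))%:E <= integral_Rn (fun z => a * t z)%R)%E.
  rewrite (integral_RnZ _ _ (ltW a0) t0 mt) -mulrA EFinM lee_wpmul2l// lee_fin.
  exact: ltW.
have AG : a * G / (1 + e) <= A.
  rewrite -lee_fin; apply: (le_trans ItE).
  have := @integral_shells R n gam y (y \o succn) m n0.
  rewrite -AE => <-; first last.
  - by move=> i im; rewrite /= nth_root_ge0 ltW ?y1.
  - by move=> i im; rewrite ltW ?gam0.
  apply: (@ae_le_integral_Rn _ _ _ _ Ng) => //; last exact: measurable_shells.
  by move=> z; apply: shells_ge0 => i im; rewrite ltW ?gam0.
have A0 : 0 < A by rewrite (lt_le_trans _ AF)// divr_gt0// addr_gt0.
have aG0 : 0 < a * G by rewrite mulr_gt0.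
have KE : a `^ (1 - l) * K <= (1 + e) * (F `^ l * (a * G) `^ (1 - l)).
  rewrite powRM ?(ltW a0) ?(ltW G0)//.
  move: KFG; rewrite -(ler_pM2l al0) => /le_trans; apply.
  by rewrite le_eqVlt; apply/orP; left; apply/eqP; ring.
have AK : A <= a `^ (1 - l) * K.
  rewrite -lee_fin -h'K.
  apply: le_trans (coupled_mass l m phi gam x y n0 l01 phi0 gam0 x0 x1 y0 y1 phigam h' h'0 mh' hM).
  rewrite lee_fin lerDl mulr_ge0//.
    by rewrite divr_ge0 ?mulr_ge0 ?exprn_ge0//; case/andP: tau0 => /ltW.
  rewrite mulr_ge0 ?(ltW (unit_ball_volume_gt0))// sumr_ge0// => i _.
  rewrite mulr_ge0 ?sqr_ge0// mulr_ge0 ?(ltW (phi0 _ (ltn_ord i)))//.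
  by rewrite !xE// 1?ltnW// subr_ge0 ltW ?u1.
have F' : F <= (1 + e) * A by move: AF; rewrite ler_pdivrMr ?addr_gt0// mulrC.
have aG' : a * G <= (1 + e) * A by move: AG; rewrite ler_pdivrMr ?addr_gt0// [A * _]mulrC.
have e2 : (1 + e) * (1 + e) <= 1 + 3 * e by nra.
have eA0 : 0 <= (1 + e) * A by rewrite mulr_ge0 ?addr_ge0 ?ltW.
have powle p q r : 0 <= r -> 0 <= p -> p <= q -> p `^ r <= q `^ r.
  by move=> r0 p0 pq; rewrite ge0_ler_powR ?nnegrE// (le_trans p0).
have KA : a `^ (1 - l) * K <= (1 + 3 * e) * A.
  apply: (le_trans KE); apply: (@le_trans _ _ ((1 + e) * ((1 + e) * A))); last first.
    by rewrite mulrA ler_wpM2r// ltW.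
  rewrite ler_wpM2l ?addr_ge0 ?(ltW e0)//.
  have -> : (1 + e) * A = ((1 + e) * A) `^ l * ((1 + e) * A) `^ (1 - l).
    rewrite -powRD; last by apply/implyP => _; rewrite gt_eqF// mulr_gt0// addr_gt0.
    by rewrite (addrC l) subrK powRr1.
  by rewrite ler_pM ?powR_ge0// powle// ltW.
(* This bounds how much filling in the level sets can add to the mass: [A] is at most nearly a
   geometric mean of [p] and [q] while [q] is at most nearly [A], so [p] cannot be much below [A].
   The weight [r] on the left costs a factor [1 / tau]. *)
have amgm p q r : 0 < r < 1 -> 0 < p -> 0 < q -> q <= (1 + e) * A ->
    A <= (1 + e) * (p `^ r * q `^ (1 - r)) -> r * (A - p) <= 3 * e * A.
  move=> /andP[r0 r1] p0 q0 qA H.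
  have H' : A <= (1 + e) * (r * p + (1 - r) * ((1 + e) * A)).
    apply: (le_trans H); rewrite ler_wpM2l ?addr_ge0 ?(ltW e0)//.
    apply: (@le_trans _ _ (r * p + (1 - r) * q)).
      by apply: powR_amgm; rewrite ?r0// ltW.
    by rewrite lerD2l ler_wpM2l// subr_ge0 ltW.
  have H2' : (1 + e) * (1 + e) * ((1 - r) * A) <= (1 + 3 * e) * ((1 - r) * A).
    by rewrite ler_wpM2r// mulr_ge0 ?subr_ge0 ?ltW.
  have h1 : 0 <= e * (r * A) := mulr_ge0 (ltW e0) (mulr_ge0 (ltW r0) (ltW A0)).
  have h2 : 0 <= e * (e * A) := mulr_ge0 (ltW e0) (mulr_ge0 (ltW e0) (ltW A0)).
  have e1' : 0 < 1 + e by rewrite addr_gt0.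
  by rewrite -(ler_pM2l e1'); lra.
have AF3 : tau * (A - F) <= 3 * e * A.
  have H : l * (A - F) <= 3 * e * A.
    by apply: (amgm F (a * G)) => //; exact: le_trans AK KE.
  have [hA|/ltW hA] := leP A F.
    apply: (@le_trans _ _ 0); last by rewrite mulr_ge0 ?(ltW A0)// mulr_ge0// ltW.
    by rewrite mulr_ge0_le0 ?subr_le0//; case/andP: tau0 => /ltW.
  by apply: le_trans H; rewrite ler_wpM2r ?subr_ge0// ge_min lexx.
have AG3 : tau * (A - a * G) <= 3 * e * A.
  have H : (1 - l) * (A - a * G) <= 3 * e * A.
    apply: (amgm (a * G) F) => //; rewrite subKr [_ `^ _ * _]mulrC.
    exact: le_trans AK KE.
  have [hA|/ltW hA] := leP A (a * G).
    apply: (@le_trans _ _ 0); last by rewrite mulr_ge0 ?(ltW A0)// mulr_ge0// ltW.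
    by rewrite mulr_ge0_le0 ?subr_le0//; case/andP: tau0 => /ltW.
  by apply: le_trans H; rewrite ler_wpM2r ?subr_ge0// ge_min lexx orbT.
have e30 : 0 < 3 * e by rewrite mulr_gt0.
have h'A : (integral_Rn h' <= ((1 + 3 * e) * A)%:E)%E by rewrite h'K lee_fin.
exists a => //; split.
  have [D [D0 mD Dp] DI] := coupled_annuli l m phi gam x y n0 l01 phi0 phim gam0 phi1 gam1
    x0 x1 y0 y1 phigam h' h'0 mh' hM (3 * e) e30 A0 h'A.
  apply: (excess_bound tau e A F (a `^ (1 - l) * K) f s h' D Nf) => // z Nz.
  exact: le_trans (sx z Nz) (Dp z).
have hM' i z : (i < m)%N ->
    euclidean_norm z < (1 - l) * y i.+1 + (1 - (1 - l)) * x i.+1 ->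
    gam i `^ (1 - l) * phi i `^ (1 - (1 - l)) <= h' z.
  by move=> im; rewrite subKr addrC [_ `^ _ * _]mulrC; exact: hM.
have gamphi i (im : (i < m)%N) := esym (phigam i im).
have A0' := A0; have h'A' := h'A; rewrite AE in A0' h'A'.
(* The bound for [a g] comes from the same coupling with the two sides exchanged; dividing by [a] at
   the end turns [a ^ (1 - l)] into [a ^ (- l)]. *)
have [D [D0 mD Dp] DI] := coupled_annuli (1 - l) m gam phi y x n0 l01' gam0 gamm phi0 gam1 phi1
  y0 y1 x0 x1 gamphi h' h'0 mh' hM' (3 * e) e30 A0' h'A'.
rewrite -AE subKr minC -/tau in DI.
have ag0 z : 0 <= a * g z by rewrite mulr_ge0 ?(ltW a0).
have mag : lebesgue_measurable (fun z => a * g z) by exact: lebesgue_measurableZ.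
have H : (integral_Rn (fun z => `|a * g z - h' z|%R) <= (C * (a * G))%:E)%E.
  apply: (excess_bound tau e A (a * G) (a `^ (1 - l) * K)
    (fun z => a * g z) (fun z => a * t z) h' D Ng) => //.
  - by move=> z; rewrite at0 ler_pM2l//; case/andP: (tg z).
  - by move=> z Nz; exact: le_trans (ty z Nz) (Dp z).
  - by rewrite integral_RnZ ?(ltW a0)// gG.
have ai0 : 0 <= a^-1 by rewrite invr_ge0 ltW.
have E z : `|g z - a `^ (- l) * h z| = a^-1 * `|a * g z - h' z|.
  rewrite -[a^-1 in RHS](ger0_norm ai0) -normrM mulrBr mulKf ?gt_eqF// /h' [in RHS]mulrA.
  congr (`| _ - _ * _|); rewrite powRD; last by apply/implyP => _; rewrite gt_eqF.
  by rewrite powRr1 ?(ltW a0)// mulKf ?gt_eqF.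
rewrite (eq_integral_Rn _ _ E) integral_RnZ//; last exact: lebesgue_measurable_dist.
apply: le_trans (lee_wpmul2l _ H) _; first by rewrite lee_fin.
by rewrite -EFinM lee_fin mulrCA mulKf ?gt_eqF.
Qed.

End radial_sup_stability.

(** * Log-concave radial functions *)

Section radial_functions.
Context {R : realType} {n : nat}.
Local Notation norm := (@euclidean_norm R n).
Implicit Types (f g h : 'rV[R]_n -> R) (x y z w : 'rV[R]_n).

Lemma euclidean_norm_eq0 x : norm x = 0 -> x = 0.
Proof.
move=> x0; apply/rowP => i; rewrite mxE; apply/eqP; rewrite -normr_le0 -x0.
exact: norm_coord_le.
Qed.

(** By radiality [z] may be replaced by [t *: w] with [0 <= t <= 1], a convex combination of [w] and
    [- w], where [h] takes the same value. *)
Lemma radial_log_concave_le h z w : (forall x, 0 <= h x) -> radial h ->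
  log_concave h -> norm z <= norm w -> h w <= h z.
Proof.
move=> h0 rh lh zw; have [w0|w0] := eqVneq (norm w) 0.
  rewrite (rh z w)//; apply/eqP; rewrite eq_le zw w0; exact: sqrtr_ge0.
have wp : 0 < norm w by rewrite lt_neqAle eq_sym w0 sqrtr_ge0.
pose t := norm z / norm w.
have t0 : 0 <= t by rewrite divr_ge0 ?sqrtr_ge0.
rewrite (rh z (t *: w)); last by rewrite euclidean_normZ ger0_norm// divfK.
have [t1|t1] := eqVneq t 1; first by rewrite t1 scale1r.
have {}t1 : t < 1 by rewrite lt_neqAle t1 ler_pdivrMr// mul1r.
pose s := (1 + t) / 2.
have s01 : 0 < s < 1 by rewrite /s; apply/andP; split; lra.
have := lh w (- w) s s01.
have -> : s *: w + (1 - s) *: (- w) = t *: w.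
  by rewrite scalerN -scalerBl; congr (_ *: _); rewrite /s; field.
rewrite (rh (- w) w); last by rewrite -scaleN1r euclidean_normZ normrN1 mul1r.
have /andP[s0 s1] := s01.
rewrite -powRD; last by apply/implyP; rewrite addrC subrK oner_eq0.
by rewrite addrC subrK powRr1.
Qed.

(** Rotating [x] and [y] onto a common ray gives their combination the norm [l |x| + (1 - l) |y|];
    [h] decreases with the norm, which covers every [z] of smaller norm. *)
Lemma radial_sup_log_concave_h l f g h : (0 < n)%N -> 0 < l < 1 ->
  (forall x, 0 <= h x) -> radial f -> radial g -> radial h -> log_concave h ->
  (forall x y, f x `^ l * g y `^ (1 - l) <= h (l *: x + (1 - l) *: y)) ->
  radial_sup l f g h.
Proof.
move=> n0 /andP[l0 l1] h0 rf rg rh lh H x y z zxy.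
pose e : 'rV[R]_n := delta_mx 0 (Ordinal n0).
have e1 : norm e = 1.
  rewrite /euclidean_norm (bigD1 (Ordinal n0))//= big1 ?addr0.
    by rewrite mxE !eqxx expr1n sqrtr1.
  by move=> i /negbTE i0; rewrite mxE i0 expr0n.
have nx : norm (norm x *: e) = norm x.
  by rewrite euclidean_normZ e1 mulr1 ger0_norm// sqrtr_ge0.
have ny : norm (norm y *: e) = norm y.
  by rewrite euclidean_normZ e1 mulr1 ger0_norm// sqrtr_ge0.
rewrite (rf _ _ (esym nx)) (rg _ _ (esym ny)); apply: le_trans (H _ _) _.
apply: radial_log_concave_le => //.
rewrite !scalerA -scalerDl euclidean_normZ e1 mulr1 ger0_norm//.
by rewrite addr_ge0// mulr_ge0 ?sqrtr_ge0 ?subr_ge0// ltW.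
Qed.

(** Here [z] is split into the multiples of itself with factors [|x| / k] and [|y| / k], of norms at
    most [|x|] and [|y|]; [f] and [g] only increase when moved there. *)
Lemma radial_sup_log_concave_fg l f g h : 0 < l < 1 ->
  (forall x, 0 <= f x) -> (forall x, 0 <= g x) ->
  radial f -> radial g -> log_concave f -> log_concave g ->
  (forall x y, f x `^ l * g y `^ (1 - l) <= h (l *: x + (1 - l) *: y)) ->
  radial_sup l f g h.
Proof.
move=> /andP[l0 l1] f0 g0 rf rg lf lg H x y z zxy.
have l1' : 0 < 1 - l by rewrite subr_gt0.
have nx := sqrtr_ge0 (\sum_(i < n) x 0 i ^+ 2); rewrite -/(norm x) in nx.
have ny := sqrtr_ge0 (\sum_(i < n) y 0 i ^+ 2); rewrite -/(norm y) in ny.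
pose k := l * norm x + (1 - l) * norm y.
have k0 : 0 <= k by rewrite addr_ge0// mulr_ge0// ltW.
have zE : l *: ((norm x / k) *: z) + (1 - l) *: ((norm y / k) *: z) = z.
  rewrite !scalerA -scalerDl !mulrA -mulrDl -/k.
  (* For [k = 0] the quotients are [0] by convention, and [z] itself is zero. *)
  have [k00|kn0] := eqVneq k 0; last by rewrite divff// scale1r.
  rewrite k00 mul0r scale0r; apply/esym/euclidean_norm_eq0/eqP.
  by rewrite eq_le sqrtr_ge0 andbT -k00.
have le_scale w : norm ((norm w / k) *: z) <= norm w.
  rewrite euclidean_normZ ger0_norm ?divr_ge0 ?sqrtr_ge0//.
  have [k00|kn0] := eqVneq k 0; first by rewrite k00 invr0 mulr0 mul0r sqrtr_ge0.
  by rewrite -mulrA ler_piMr ?sqrtr_ge0// mulrC ler_pdivrMr ?mul1r// lt_neqAle eq_sym kn0.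
rewrite -zE; apply: le_trans (H _ _).
have fx := radial_log_concave_le f _ _ f0 rf lf (le_scale x).
have gy := radial_log_concave_le g _ _ g0 rg lg (le_scale y).
by rewrite ler_pM ?powR_ge0// ge0_ler_powR ?nnegrE// ltW.
Qed.

Lemma log_concaveZ (k : R) f : 0 < k -> (forall x, 0 <= f x) ->
  log_concave f -> log_concave (fun x => k * f x).
Proof.
move=> k0 f0 lf x y s s01; rewrite !powRM ?(ltW k0)// mulrACA -powRD; last first.
  by apply/implyP => _; rewrite gt_eqF.
by rewrite addrC subrK powRr1 ?(ltW k0)// ler_pM2l// lf.
Qed.

Lemma log_concave0 : log_concave (fun _ : 'rV[R]_n => 0 : R).
Proof. by move=> x y s /andP[s0 _]; rewrite powR0 ?mul0r// gt_eqF. Qed.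

End radial_functions.

(** * Choice of the log-concave profile *)

Theorem theorem3 (R : realType) (n : nat) (n_ge1 : (1 <= n)%N) :
  exists2 C : R, 0 < C &
  forall (lambda eps : R) (h f g : 'rV[R]_n -> R),
    let tau := Num.min lambda (1 - lambda) in
    0 < lambda < 1 -> 0 < eps ->
    (forall x, 0 <= h x) -> (forall x, 0 <= f x) -> (forall x, 0 <= g x) ->
    lebesgue_measurable h -> lebesgue_measurable f -> lebesgue_measurable g ->
    radial h -> radial f -> radial g ->
    (0 < integral_Rn f < +oo)%E -> (0 < integral_Rn g < +oo)%E ->
    (forall x y : 'rV[R]_n,
      h (lambda *: x + (1 - lambda) *: y) >=
        f x `^ lambda * g y `^ (1 - lambda)) ->
    (log_concave h \/ (log_concave f /\ log_concave g)) ->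
    (integral_Rn h <=
      (1 + eps)%:E * (integral_Rn f `^ lambda * integral_Rn g `^ (1 - lambda)))%E ->
  exists (a : R) (ht : 'rV[R]_n -> R),
    [/\ 0 < a, forall x, 0 <= ht x, radial ht & log_concave ht] /\
    [/\ (integral_Rn (fun x => `|f x - a `^ (1 - lambda) * ht x|%R) <=
          (C * (eps / tau) `^ (1 / 2))%:E * integral_Rn f)%E,
        (integral_Rn (fun x => `|g x - a `^ (- lambda) * ht x|%R) <=
          (C * (eps / tau) `^ (1 / 2))%:E * integral_Rn g)%E &
        (integral_Rn (fun x => `|h x - ht x|%R) <=
          (C * (eps / tau) `^ (1 / 2))%:E * integral_Rn h)%E].
Proof.
pose C0 : R := 14 + 32 * n%:R.
have n0 : 0 <= n%:R :> R by [].
have C0_gt0 : 0 < C0 by rewrite /C0; lra.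
(* The factor [4] is [1 + 3], from the triangle inequality for [g] when only [f] and [g] are
   log-concave. *)
exists (4 * C0); first by rewrite mulr_gt0.
move=> l e h f g tau l01 e0 h0 f0 g0 mh mf mg rh rf rg.
move=> /andP[fI fI'] /andP[gI gI'] fgh lc hI.
have /andP[l0 l1] := l01.
have tau0 : 0 < tau by rewrite lt_min l0 subr_gt0.
have r0 : 0 < e / tau by rewrite divr_gt0.
rewrite div1r powR12_sqrt ?(ltW r0)//; set q := Num.sqrt (e / tau).
have q0 : 0 < q by rewrite sqrtr_gt0.
(* If [C0 q > 1/2], the allowed relative error exceeds [1] and the zero profile works. Otherwise
   [C0 >= 14] gives [q <= 1/28], more than the threshold [1/6] on [e / tau = q ^+ 2] requires. *)
have [Cq|Cq] := ltP (1 / 2) (C0 * q).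
  have k1 : (1 <= (4 * C0 * q)%:E)%E by rewrite lee_fin -mulrA; lra.
  exists 1, (fun=> 0); split; first by split => //; exact: log_concave0.
  have E (k : 'rV[R]_n -> R) b : (forall x, 0 <= k x) ->
      integral_Rn (fun x => `|k x - b * 0|) = integral_Rn k.
    by move=> k0; apply: eq_integral_Rn => x; rewrite mulr0 subr0 ger0_norm.
  split; rewrite ?E//; try by apply: lee_pemull => //; exact: integral_Rn_ge0.
  rewrite (@eq_integral_Rn _ _ _ h).
    by apply: lee_pemull => //; exact: integral_Rn_ge0.
  by move=> x; rewrite subr0 ger0_norm.
pose F := fine (integral_Rn f); pose G := fine (integral_Rn g).
have fF : integral_Rn f = F%:E by rewrite fineK// ge0_fin_numE// ltW.
have gG : integral_Rn g = G%:E by rewrite fineK// ge0_fin_numE// ltW.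
have F0 : 0 < F by rewrite -lte_fin -fF.
have G0 : 0 < G by rewrite -lte_fin -gG.
have etau : e / tau <= 1 / 6.
  have -> : e / tau = q ^+ 2 by rewrite sqr_sqrtr// ltW.
  have : 14 * q <= C0 * q by rewrite ler_wpM2r ?(ltW q0)// /C0; lra.
  by nra.
have fgh' : radial_sup l f g h.
  case: lc => [lh|[lf lg]]; first exact: radial_sup_log_concave_h.
  exact: radial_sup_log_concave_fg.
have hI' : (integral_Rn h <= ((1 + e) * (F `^ l * G `^ (1 - l)))%:E)%E.
  by move: hI; rewrite fF gG !poweR_EFin -!EFinM.
have [a a0 [faI gaI]] :=
  radial_sup_stability n_ge1 l e f g h F G l01 e0 etau f0 g0 h0 mf mg mh F0 G0 fF gG fgh' hI'.
rewrite -/C0 -/tau -/q in faI gaI.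
have hfin : (integral_Rn h < +oo)%E by apply: le_lt_trans hI' _; rewrite ltry.
pose K := fine (integral_Rn h).
have hK : integral_Rn h = K%:E by rewrite fineK// ge0_fin_numE// integral_Rn_ge0.
have K0 : 0 <= K by rewrite -lee_fin -hK integral_Rn_ge0.
rewrite fF gG hK -!EFinM.
have zero_le (k : 'rV[R]_n -> R) (c : R) : (forall x, k x = 0) -> 0 <= c ->
    (integral_Rn k <= c%:E)%E.
  move=> k0 c0; rewrite (@eq_integral_Rn _ _ _ (cst 0) k0) /integral_Rn integral0.
  by rewrite lee_fin.
have Cq0 : 0 <= 4 * C0 * q by rewrite !mulr_ge0// ltW.
have weaken I : 0 <= I -> C0 * q * I <= 4 * C0 * q * I.
  by move=> I0; rewrite ler_wpM2r// -mulrA ler_peMl ?mulr_ge0 ?(ltW C0_gt0) ?(ltW q0)// ler1n.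
case: lc => [lh|[lf lg]].
  exists a, h; split; first by split.
  split.
  - by apply: (le_trans faI); rewrite lee_fin weaken// ltW.
  - by apply: (le_trans gaI); rewrite lee_fin weaken// ltW.
  - by apply: zero_le => [x|]; [rewrite subrr normr0|rewrite mulr_ge0].
(* In this case [h] may fail to be log-concave, so the profile is [f / b]: the error for [f]
   vanishes, those for [g] and [h] pass through [h]. *)
set b := a `^ (1 - l); have b0 : 0 < b by rewrite powR_gt0.
have bE : b = a * a `^ (- l).
  rewrite /b powRD; last by apply/implyP => _; rewrite gt_eqF.
  by rewrite powRr1// ltW.
have al0 : 0 < a `^ (- l) by rewrite powR_gt0.
have mbh : lebesgue_measurable (fun x => b * h x) by exact: lebesgue_measurableZ.
have mah : lebesgue_measurable (fun x => a `^ (- l) * h x) by exact: lebesgue_measurableZ.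
have mfb := lebesgue_measurable_dist _ _ mf mbh.
have mga := lebesgue_measurable_dist _ _ mg mah.
have bh0 x : 0 <= b * h x by rewrite mulr_ge0// ltW.
have FK : F <= 2 * (b * K).
  have : (F%:E <= (C0 * q * F + b * K)%:E)%E.
    rewrite -fF EFinD (EFinM b) -hK -(integral_RnZ b h (ltW b0) h0 mh).
    apply: (@le_trans _ _ (integral_Rn (fun x => `|f x - b * h x| + b * h x))).
      apply: le_integral_Rn => // [x||x]; first by rewrite addr_ge0.
        exact: lebesgue_measurableD.
      by rewrite -lerBlDr ler_norm.
    by rewrite integral_RnD//; exact: leeD2r.
  have : C0 * q * F <= 1 / 2 * F by rewrite ler_wpM2r// ltW.
  by rewrite lee_fin; lra.
have KG : a `^ (- l) * K <= 3 / 2 * G.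
  have : ((a `^ (- l) * K)%:E <= (G + C0 * q * G)%:E)%E.
    rewrite EFinM -hK -(integral_RnZ _ h (ltW al0) h0 mh).
    apply: (@le_trans _ _ (integral_Rn (fun x => g x + `|g x - a `^ (- l) * h x|))).
      apply: le_integral_Rn => // [x|x||x]; first by rewrite mulr_ge0// ltW.
      - by rewrite addr_ge0.
      - exact: lebesgue_measurableD.
      - by have := ler_norm (a `^ (- l) * h x - g x); rewrite distrC; lra.
    by rewrite integral_RnD// gG EFinD; exact: leeD2l.
  have : C0 * q * G <= 1 / 2 * G by rewrite ler_wpM2r// ltW.
  by rewrite lee_fin; lra.
(* Converts an error relative to [F] into one relative to [G]: since [b / a = a ^ (- l)], the bounds
   [FK] and [KG] give [2] times [3/2]. *)
have FG : a^-1 * F <= 3 * G.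
  rewrite mulrC ler_pdivrMr//; apply: (le_trans FK); rewrite bE.
  by have := ler_wpM2l (ltW a0) KG; lra.
exists a, (fun x => b^-1 * f x); split.
  split => //.
  - by move=> x; rewrite mulr_ge0// invr_ge0 ltW.
  - by move=> x y xy; rewrite (rf x y xy).
  - by apply: log_concaveZ; rewrite ?invr_gt0.
have bi0 : 0 <= b^-1 by rewrite invr_ge0 ltW.
have ai0 : 0 <= a^-1 by rewrite invr_ge0 ltW.
split.
- apply: zero_le => [x|]; last by rewrite mulr_ge0// ltW.
  by rewrite -/b mulVKf ?gt_eqF// subrr normr0.
- apply: (@le_trans _ _ (integral_Rn (fun x => `|g x - a `^ (- l) * h x|
      + a^-1 * `|f x - b * h x|))).
    apply: le_integral_Rn => // [x|||x].
    + by rewrite addr_ge0// mulr_ge0.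
    + apply: lebesgue_measurable_dist => //; do 2 apply: lebesgue_measurableZ => //.
    + apply: lebesgue_measurableD => //; exact: lebesgue_measurableZ.
    + have -> : g x - a `^ (- l) * (b^-1 * f x)
          = (g x - a `^ (- l) * h x) - a^-1 * (f x - b * h x).
        by rewrite bE; field; rewrite !gt_eqF.
      by rewrite (le_trans (ler_normB _ _))// lerD2l normrM ger0_norm.
  rewrite integral_RnD//; first last.
  + exact: lebesgue_measurableZ.
  + by move=> x; rewrite mulr_ge0.
  rewrite integral_RnZ//.
  apply: (@le_trans _ _ ((C0 * q * G)%:E + a^-1%:E * (C0 * q * F)%:E)%E).
    by apply: leeD gaI _; apply: lee_wpmul2l faI; rewrite lee_fin.
  rewrite -EFinM -EFinD lee_fin.
  have : C0 * q * (a^-1 * F) <= C0 * q * (3 * G) by rewrite ler_wpM2l// mulr_ge0// ltW.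
  by lra.
- rewrite (@eq_integral_Rn _ _ _ (fun x => b^-1 * `|f x - b * h x|)); last first.
    move=> x; rewrite -[in RHS](ger0_norm bi0) -normrM mulrBr mulKf ?gt_eqF//.
    by rewrite distrC.
  rewrite integral_RnZ//; apply: le_trans (lee_wpmul2l _ faI) _; first by rewrite lee_fin.
  rewrite -EFinM lee_fin mulrCA.
  have : b^-1 * F <= 2 * K by rewrite mulrC ler_pdivrMr//; lra.
  move=> H; apply: (@le_trans _ _ (C0 * q * (2 * K))).
    by rewrite ler_wpM2l// mulr_ge0// ltW.
  have : 0 <= C0 * q * K by rewrite !mulr_ge0// ltW.
  by lra.
Qed.
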